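(* The following is the list of all equivalence classes of prime abelian anyon theories; that is, each of the following theories is a prime abelian anyon theory, its equivalence class does not depend on the choice of the integer $u$ used to define it, and every prime abelian anyon theory is equivalent to exactly one of them. Here $k\geq 1$ is an integer. (i) For $p\neq 2$ a prime and $\epsilon=\pm1$, $\omega_{p,k}^{\epsilon}$ denotes the abelian anyon theory with group $\mathbb{Z}/p^k\mathbb{Z}$ and abelian 3-cocycle $(0,c)$, where $c(x,y)=\frac{uxy}{p^k}\ (\mathrm{mod}\ \mathbb{Z})$ for some $u\in\mathbb{Z}^{>0}$ with $(p,u)=1$ and $\left(\frac{2u}{p}\right)=\epsilon$. (ii) For $\epsilon\in(\mathbb{Z}/8\mathbb{Z})^{\times}$, $\omega_{2,k}^{\epsilon}$ denotes the abelian anyon theory with group $\mathbb{Z}/2^k\mathbb{Z}$ and abelian 3-cocycle $(\omega,c)$ given, for representatives $x,y,z\in\{0,1,\dots,2^k-1\}$, by $$c(x,y)=\frac{uxy}{2^{k+1}}\ (\mathrm{mod}\ \mathbb{Z}),\qquad \omega(x,y,z)=\begin{cases}\frac{x}{2}\ (\mathrm{mod}\ \mathbb{Z}) & \text{if } y+z\geq 2^k,\\ 0\ (\mathrm{mod}\ \mathbb{Z}) & \text{otherwise,}\end{cases}$$ for some $u\in\mathbb{Z}^{>0}$ with $u\equiv\epsilon\ (\mathrm{mod}\ 8)$. The theories $\omega_{2,k}^{1}$ and $\omega_{2,k}^{-1}$ are defined for all $k\geq1$, and $\omega_{2,k}^{5}$ and $\omega_{2,k}^{-5}$ for all $k\geq2$.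 (iii) $E_k$ denotes the abelian anyon theory with group $\mathbb{Z}/2^k\mathbb{Z}\oplus\mathbb{Z}/2^k\mathbb{Z}$ and abelian 3-cocycle $(0,c)$, where $c$ is the bilinear map to $\mathbb{R}/\mathbb{Z}$ with $c(\vec e_1,\vec e_1)=c(\vec e_2,\vec e_2)=c(\vec e_2,\vec e_1)=0$ and $c(\vec e_1,\vec e_2)=2^{-k}\ (\mathrm{mod}\ \mathbb{Z})$. (iv) $F_k$ denotes the abelian anyon theory with group $\mathbb{Z}/2^k\mathbb{Z}\oplus\mathbb{Z}/2^k\mathbb{Z}$ and abelian 3-cocycle $(0,c)$, where $c$ is the bilinear map to $\mathbb{R}/\mathbb{Z}$ with $c(\vec e_1,\vec e_1)=c(\vec e_2,\vec e_2)=2^{-k}$, $c(\vec e_2,\vec e_1)=0$ and $c(\vec e_1,\vec e_2)=-2^{-k}\ (\mathrm{mod}\ \mathbb{Z})$. In (iii) and (iv), $\vec e_1=(1,0)$ and $\vec e_2=(0,1)$.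
   Context: An abelian theory is a triple $(A,\omega,c)$ with $A$ a finite abelian group (written additively) and $(\omega,c)\in Z^3_{ab}(A,\mathbb{R}/\mathbb{Z})$ an abelian 3-cocycle, i.e. maps $\omega:A^3\to\mathbb{R}/\mathbb{Z}$, $c:A\times A\to\mathbb{R}/\mathbb{Z}$ such that for all $x,y,z,t\in A$: (a) $\omega(y,z,t)-\omega(x+y,z,t)+\omega(x,y+z,t)-\omega(x,y,z+t)+\omega(x,y,z)=0$; (b) $c(x,z)-c(x,y+z)+c(x,y)+\omega(x,y,z)-\omega(y,x,z)+\omega(y,z,x)=0$; (c) $c(y,z)-c(x+y,z)+c(x,z)-\omega(x,y,z)+\omega(x,z,y)-\omega(z,x,y)=0$. Two abelian 3-cocycles on $A$ are cohomologous if their difference is of the form $(\omega_f,c_f)$ for some map $f:A\times A\to\mathbb{R}/\mathbb{Z}$, where $\omega_f(x,y,z)=f(y,z)-f(x+y,z)+f(x,y+z)-f(x,y)$ and $c_f(x,y)=f(x,y)-f(y,x)$. The associated quadratic form is $q:A\to\mathbb{R}/\mathbb{Z}$, $q(a)=c(a,a)$, and $b_q(a,b)=q(a+b)-q(a)-q(b)$ is the associated symmetric bilinear form. An abelian anyon theory (anyonic abelian theory) is an abelian theory whose $b_q$ is non-degenerate. An abelian anyon theory $(A,\omega,c)$ with $A\neq0$ is prime if for every nontrivial proper subgroup $B\subset A$ the restriction of $b_q$ to $B\times B$ is degenerate. Two abelian theories $(A,\omega,c)$ and $(A',\omega',c')$ are equivalent if there is a group isomorphism $f:A\to A'$ such that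 $(f^*\omega',f^*c')$ and $(\omega,c)$ are cohomologous; equivalently (by the Eilenberg–MacLane theorem that $(\omega,c)\mapsto q$ induces an isomorphism from abelian 3-cohomology to quadratic forms) $q'(f(a))=q(a)$ for all $a\in A$. $\left(\frac{\cdot}{p}\right)$ is the Legendre symbol. *)

(* Defs.v *)
From HB Require Import structures.
From mathcomp Require Import all_boot all_order all_algebra all_fingroup.
From mathcomp Require Import reals.

Set Implicit Arguments.
Unset Strict Implicit.
Unset Printing Implicit Defensive.

Import Order.TTheory GRing.Theory Num.Theory.
Local Open Scope ring_scope.

(* [Num.int_num_subdef] is the predicate underlying [Num.int]; the qualifier
   itself is not recognised as a [zmodClosed]. *)
Definition RmodZ (R : realType) : zmodType :=
  {ideal_quot (GRing.ZmodClosed.clone R (@Num.int_num_subdef R) _)}.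

Definition modZ (R : realType) (x : R) : RmodZ R := (\pi x)%qT.

Lemma modZ_is_zmod_morphism (R : realType) : zmod_morphism (@modZ R).
Proof. exact: (raddfB (\pi_(RmodZ R))%qT). Qed.

HB.instance Definition _ (R : realType) :=
  GRing.isZmodMorphism.Build R (RmodZ R) (@modZ R) (@modZ_is_zmod_morphism R).

Lemma modZ_surj (R : realType) (a : RmodZ R) : exists x : R, modZ x = a.
Proof. by exists (generic_quotient.repr a); rewrite /modZ reprK. Qed.

Lemma modZ_eq0 (R : realType) (x : R) : (modZ x == 0) = (x \is a Num.int).
Proof. by rewrite -(raddf0 (@modZ R)) -[LHS]Quotient.idealrBE subr0. Qed.

(* The data (A, omega, c), with no condition imposed on omega and c. *)
Record abelian_datum (R : realType) := AbelianDatum {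
  group_of :> finZmodType;
  assoc : group_of -> group_of -> group_of -> RmodZ R;
  braid : group_of -> group_of -> RmodZ R
}.

Section AbelianTheories.
Variable R : realType.

Definition abelian_3cocycle (A : zmodType)
    (w : A -> A -> A -> RmodZ R) (c : A -> A -> RmodZ R) : Prop :=
  [/\ forall x y z t : A,
        w y z t - w (x + y) z t + w x (y + z) t - w x y (z + t) + w x y z = 0,
      forall x y z : A,
        c x z - c x (y + z) + c x y + w x y z - w y x z + w y z x = 0
    & forall x y z : A,
        c y z - c (x + y) z + c x z - w x y z + w x z y - w z x y = 0].

Definition cohomologous (A : zmodType)
    (w1 : A -> A -> A -> RmodZ R) (c1 : A -> A -> RmodZ R)
    (w2 : A -> A -> A -> RmodZ R) (c2 : A -> A -> RmodZ R) : Prop :=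
  exists f : A -> A -> RmodZ R,
    (forall x y z : A,
       w1 x y z - w2 x y z = f y z - f (x + y) z + f x (y + z) - f x y) /\
    (forall x y : A, c1 x y - c2 x y = f x y - f y x).

Definition is_abelian_theory (D : abelian_datum R) : Prop :=
  abelian_3cocycle (@assoc R D) (@braid R D).

Definition qform (D : abelian_datum R) (a : D) : RmodZ R := braid a a.

Definition bform (D : abelian_datum R) (a b : D) : RmodZ R :=
  qform (a + b) - qform a - qform b.

Definition nondegenerate_on (D : abelian_datum R) (B : {set D}) : Prop :=
  forall a : D, a \in B -> (forall b : D, b \in B -> bform a b = 0) -> a = 0.

Definition is_anyon_theory (D : abelian_datum R) : Prop :=
  is_abelian_theory D /\ nondegenerate_on [set: D].

(* [{group D}] is the type of subgroups of the additive group of [D]. *)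
Definition is_prime_anyon_theory (D : abelian_datum R) : Prop :=
  [/\ is_anyon_theory D,
      exists a : D, a != 0
    & forall B : {group D},
        B != 1%G -> B \proper [set: D] -> ~ nondegenerate_on B].

Definition equivalent (D D' : abelian_datum R) : Prop :=
  exists f : {additive D -> D'},
    bijective f /\
    cohomologous (fun x y z : D => assoc (f x) (f y) (f z))
                 (fun x y : D => braid (f x) (f y))
                 (@assoc R D) (@braid R D).

End AbelianTheories.

(* Meant for p an odd prime. *)
Definition legendre (p a : nat) : int :=
  if (p %| a)%N then 0
  else if [exists x : 'I_p, (x ^ 2 == a %[mod p])%N] then 1 else -1.

(* In the two definitions below, x, y, z : 'Z_n are read as their
   representatives in {0, ..., n - 1}. *)
Definition odd_datum (R : realType) (p k u : nat) : abelian_datum R :=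
  @AbelianDatum R 'Z_(p ^ k) (fun _ _ _ => 0)
    (fun x y => modZ ((u * x * y)%N%:R / (p ^ k)%N%:R)).

Definition two_datum (R : realType) (k u : nat) : abelian_datum R :=
  @AbelianDatum R 'Z_(2 ^ k)
    (fun x y z => if (2 ^ k <= y + z)%N then modZ ((x : nat)%:R / 2) else 0)
    (fun x y => modZ ((u * x * y)%N%:R / (2 ^ k.+1)%N%:R)).

Definition biadditive (A B : zmodType) (c : A -> A -> B) : Prop :=
  (forall x y z : A, c (x + y) z = c x z + c y z) /\
  (forall x y z : A, c x (y + z) = c x y + c x z).

(* Infers the missing [finZmodType] instance on products. *)
HB.saturate prod.

Definition Z2k2 (k : nat) : finZmodType := ('Z_(2 ^ k) * 'Z_(2 ^ k))%type.
Definition e1 (k : nat) : Z2k2 k := (1, 0).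
Definition e2 (k : nat) : Z2k2 k := (0, 1).

Inductive theory_name :=
  | OmegaOdd (p k : nat) (eps : int)
  | OmegaTwo (k : nat) (eps : 'Z_8)
  | TypeE (k : nat)
  | TypeF (k : nat).

Definition listed (l : theory_name) : Prop :=
  match l with
  | OmegaOdd p k eps =>
      [/\ prime p, p <> 2%N, (1 <= k)%N & eps = 1 \/ eps = -1]
  | OmegaTwo k eps =>
      ((1 <= k)%N /\ (eps = 1 \/ eps = -1)) \/
      ((2 <= k)%N /\ (eps = 5 \/ eps = -5))
  | TypeE k => (1 <= k)%N
  | TypeF k => (1 <= k)%N
  end.

(* [denotes l D]: D is obtained from one of the choices (of u, or of the
   bilinear map c) allowed in the description of the listed theory l. *)
Definition denotes (R : realType) (l : theory_name) (D : abelian_datum R) : Prop :=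
  match l with
  | OmegaOdd p k eps =>
      exists u : nat, [/\ (0 < u)%N, coprime p u, legendre p (2 * u) = eps
                        & D = odd_datum R p k u]
  | OmegaTwo k eps =>
      exists u : nat, [/\ (0 < u)%N, u%:R = eps & D = two_datum R k u]
  | TypeE k =>
      exists c : Z2k2 k -> Z2k2 k -> RmodZ R,
        [/\ biadditive c,
            [/\ c (e1 k) (e1 k) = 0, c (e2 k) (e2 k) = 0
              & c (e2 k) (e1 k) = 0],
            c (e1 k) (e2 k) = modZ (2 ^- k)
          & D = AbelianDatum (fun _ _ _ => 0) c]
  | TypeF k =>
      exists c : Z2k2 k -> Z2k2 k -> RmodZ R,
        [/\ biadditive c,
            c (e1 k) (e1 k) = modZ (2 ^- k) /\ c (e2 k) (e2 k) = modZ (2 ^- k),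
            c (e2 k) (e1 k) = 0,
            c (e1 k) (e2 k) = modZ (- 2 ^- k)
          & D = AbelianDatum (fun _ _ _ => 0) c]
  end.

(* Main.v *)
From HB Require Import structures.
Require Import Defs.
From mathcomp Require Import all_boot all_order all_algebra all_fingroup all_solvable.
From mathcomp Require Import boolp reals.
From mathcomp Require Import zify ring.

Set Implicit Arguments.
Unset Strict Implicit.
Unset Printing Implicit Defensive.

Import Order.TTheory GRing.Theory Num.Theory.
Local Open Scope ring_scope.

(* The quadratic form q(a) = c(a,a) determines the theory: after subtracting a
   cocycle it suffices to show that q = 0 forces (w,c) to be a coboundary. On B x Z/n,
   with e the generator of Z/n, three successive gauge changes make w(x,y,e), c(x,e) and
   w(x,e,y) vanish; the obstructions are sums over the cosets of <e>, and they vanish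
   because n q(e) = 0, because R/Z is divisible and because c is antisymmetric. The
   cocycle is then invariant under translation by e in every variable and descends to B.

   For the classification, a nondegenerate subgroup of a prime theory is everything. Let
   x have maximal p-power order p^k and let b(x,y) have exact order p^k. If p is odd, one
   of x, y, x + y generates a nondegenerate cyclic subgroup. If p = 2, either x or y does
   so, or x, y span a nondegenerate (Z/2^k)^2 on which Newton's iteration brings q to the
   form st or s^2 - st + t^2, according to whether it represents 0 primitively mod 2. *)

(** * Identities in abelian groups *)

(** The prime 2 is the obstacle in the classification. Since b(x,x) = 2 q(x), an element killed by
    2^k only has q(x) in 2^-(k+1) Z/Z. If the numerator of such a value is odd, the element spans a
    nondegenerate cyclic subgroup. Otherwise b(x,x) and b(y,y) are even multiples of 2^-k, and what
    saves the pair x, y is the determinant 4 al be - ga^2 of b, odd because the numerator ga of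
    b(x,y) is; this is the origin of the rank two theories. Uniqueness reads the name off invariants
    of q. Order and exponent of the group give p, k and the rank. On a cyclic group the values of q
    at generators form one class u n^2 with n prime to p, so the Legendre symbol of 2u is an
    invariant for odd p; odd squares are 1 modulo 8, so for p = 2 the residue of u modulo 8 is one
    as soon as the denominator 2^(k+1) is at least 8. For k = 1 it is 4, the integers u and u + 4
    give the same form, and 5 and -5 leave the list. *)

(* Reflexive decision of the identities that hold in every abelian group;
   [ring] does not apply to R/Z, which is not a ring. *)
Inductive zexpr := ZVar of nat | ZZero | ZAdd of zexpr & zexpr | ZOpp of zexpr.

Fixpoint zeval (M : zmodType) (env : seq M) (e : zexpr) : M :=
  match e with
  | ZVar i => env`_i
  | ZZero => 0
  | ZAdd e1 e2 => zeval env e1 + zeval env e2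
  | ZOpp e1 => - zeval env e1
  end.

Fixpoint zcoef (e : zexpr) (i : nat) : int :=
  match e with
  | ZVar j => (i == j)%:Z
  | ZZero => 0
  | ZAdd e1 e2 => intZmod.addz (zcoef e1 i) (zcoef e2 i)
  | ZOpp e1 => intZmod.oppz (zcoef e1 i)
  end.

Lemma zevalE (M : zmodType) (env : seq M) (e : zexpr) :
  zeval env e = \sum_(i < size env) env`_i *~ zcoef e i.
Proof.
elim: e => [j||e1 IH1 e2 IH2|e1 IH1] /=.
- have [ltj|lej] := ltnP j (size env); last first.
    rewrite nth_default // big1 // => i _.
    by case: eqP => [ij|]; rewrite ?mulr0z //; move: (ltn_ord i); rewrite ij ltnNge lej.
  rewrite (bigD1 (Ordinal ltj)) //= eqxx mulr1z big1 ?addr0 // => i.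
  by rewrite -val_eqE /= => /negPf->; rewrite mulr0z.
- by rewrite big1 // => i _; rewrite mulr0z.
- by rewrite IH1 IH2 -big_split; apply: eq_bigr => i _; exact: (esym (mulrzDr _ _ _)).
- by rewrite IH1 -sumrN; apply: eq_bigr => i _; rewrite -mulrNz.
Qed.

Lemma zeval_eq (M : zmodType) (env : seq M) (e1 e2 : zexpr) :
  all (fun i => zcoef e1 i == zcoef e2 i) (iota 0 (size env)) ->
  zeval env e1 = zeval env e2.
Proof.
move=> /allP eq12; rewrite !zevalE; apply: eq_bigr => i _.
by rewrite (eqP (eq12 i _)) // mem_iota /=.
Qed.

Ltac zmem a l :=
  match l with
  | ?b :: _ => let _ := match goal with _ => unify a b end in constr:(true)
  | _ :: ?l' => zmem a l'
  | _ => constr:(false)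
  end.

Ltac zatoms t l :=
  match t with
  | (?x + ?y)%R => let l := zatoms x l in zatoms y l
  | (- ?x)%R => zatoms x l
  | 0%R => l
  | _ => match zmem t l with true => l | _ => constr:(t :: l) end
  end.

Ltac zindex a l :=
  match l with
  | ?b :: _ => let _ := match goal with _ => unify a b end in constr:(0%N)
  | _ :: ?l' => let n := zindex a l' in constr:(S n)
  end.

Ltac zreify t l :=
  match t with
  | (?x + ?y)%R => let a := zreify x l in let b := zreify y l in constr:(ZAdd a b)
  | (- ?x)%R => let a := zreify x l in constr:(ZOpp a)
  | 0%R => constr:(ZZero)
  | _ => let i := zindex t l in constr:(ZVar i)
  end.

Ltac zmod :=
  match goal with |- @eq ?T ?x ?y =>
    let l := zatoms x (@nil T) in
    let l := zatoms y l in
    let a := zreify x l in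
    let b := zreify y l in
    refine (@zeval_eq _ l a b _); vm_compute; reflexivity
  end.

(** The pattern for deriving an identity from others: form a combination of known equations with
    [eqrD2] and [eqrN2], then let [zmod] or [ring] check that both equations have the same
    difference of sides. *)
Lemma eqr_comb (M : zmodType) (x y x' y' : M) : x' = y' -> x - y = x' - y' -> x = y.
Proof. by move=> ->; rewrite subrr => /subr0_eq. Qed.

Lemma eqrD2 (M : zmodType) (x y x' y' : M) : x = y -> x' = y' -> x + x' = y + y'.
Proof. by move=> -> ->. Qed.

Lemma eqrN2 (M : zmodType) (x y : M) : x = y -> - x = - y.
Proof. by move=> ->. Qed.

(** * Abelian 3-cocycles with vanishing quadratic form *)

Section Forms.
Variables (R : realType) (A : zmodType).
Implicit Types (w : A -> A -> A -> RmodZ R) (c : A -> A -> RmodZ R).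

(** By [cocycle_diagD] this is the form b_q of q(x) = c(x,x). *)
Definition polar c (x y : A) : RmodZ R := c x y + c y x.

(** The hexagons (c) at (x,y,z) and (b) at (z,x,y) have opposite associator terms. *)
Lemma polarDl w c : abelian_3cocycle w c ->
  forall x y z, polar c (x + y) z = polar c x z + polar c y z.
Proof.
move=> [_ Hb Hc] x y z; rewrite /polar.
apply: (eqr_comb (eqrN2 (eqrD2 (Hc x y z) (Hb z x y)))); zmod.
Qed.

(** Three hexagons expand c(x+y,x+y); the associator terms that remain are the pentagon at
    (x,y,x,y). *)
Lemma cocycle_diagD w c : abelian_3cocycle w c ->
  forall x y, c (x + y) (x + y) = c x x + c y y + polar c x y.
Proof.
move=> [Ha Hb Hc] x y; rewrite /polar.
have H1 := Hc x y (x + y); have H2 := Hb x x y; have H3 := Hb y x y.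
have H4 := Ha x y x y; have yx : y + x = x + y := addrC y x; rewrite yx in H4.
apply: (eqr_comb (eqrD2 (eqrN2 (eqrD2 (eqrD2 H1 H2) H3)) H4)); zmod.
Qed.

End Forms.

Section Coboundaries.
Variables (R : realType) (A : zmodType).
Implicit Types (w : A -> A -> A -> RmodZ R) (c f : A -> A -> RmodZ R).

Definition dassoc f (x y z : A) : RmodZ R := f y z - f (x + y) z + f x (y + z) - f x y.
Definition dbraid f (x y : A) : RmodZ R := f x y - f y x.

Definition coboundary w c : Prop := cohomologous w c (fun _ _ _ => 0) (fun _ _ => 0).

Lemma cocycle_sub w c w' c' :
  abelian_3cocycle w c -> abelian_3cocycle w' c' ->
  abelian_3cocycle (fun x y z => w x y z - w' x y z) (fun x y => c x y - c' x y).
Proof.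
move=> [Ha Hb Hc] [Ha' Hb' Hc']; split=> [x y z t|x y z|x y z].
- apply: (eqr_comb (eqrD2 (Ha x y z t) (eqrN2 (Ha' x y z t)))); zmod.
- apply: (eqr_comb (eqrD2 (Hb x y z) (eqrN2 (Hb' x y z)))); zmod.
- apply: (eqr_comb (eqrD2 (Hc x y z) (eqrN2 (Hc' x y z)))); zmod.
Qed.

Lemma dcocycle f : abelian_3cocycle (dassoc f) (dbraid f).
Proof.
have C (a b : A) : b + a = a + b := addrC b a.
have L (a b d : A) : a + b + d = a + (b + d) := esym (addrA a b d).
split=> [x y z t|x y z|x y z]; rewrite /dassoc /dbraid; first by rewrite !L; zmod.
- by rewrite (C y x) (C z x) (C z y); zmod.
- by rewrite (C y x) (C z x) (C z y); zmod.
Qed.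

Lemma coboundary_sub w c f :
  coboundary (fun x y z => w x y z - dassoc f x y z) (fun x y => c x y - dbraid f x y) ->
  coboundary w c.
Proof.
move=> [g [gw gc]]; exists (fun x y => g x y + f x y); split=> [x y z|x y].
- by apply: (eqr_comb (gw x y z)); rewrite /dassoc; zmod.
- by apply: (eqr_comb (gc x y)); rewrite /dbraid; zmod.
Qed.

Lemma braid_antisym w c : abelian_3cocycle w c -> (forall x, c x x = 0) ->
  forall x y, c y x = - c x y.
Proof.
move=> wc c0 x y; have := cocycle_diagD wc x y; rewrite !c0 /polar => H.
by apply: (eqr_comb (esym H)); zmod.
Qed.

End Coboundaries.

Lemma RmodZ_divisible (R : realType) (n : nat) :
  exists h : RmodZ R -> RmodZ R, forall x, h x *+ n.+1 = x.
Proof.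
exists (fun x => modZ (generic_quotient.repr x / n.+1%:R)) => x.
by rewrite -raddfMn /= -[_ *+ _]mulr_natr divfK ?pnatr_eq0 // /modZ reprK.
Qed.

(** * Gauge reduction along a cyclic subgroup *)

Section Reduction.
Variables (R : realType) (A : zmodType) (e : A) (n : nat).
Hypothesis e_order : e *+ n.+1 = 0.
Implicit Types (w : A -> A -> A -> RmodZ R) (c : A -> A -> RmodZ R) (g : A -> RmodZ R).

(** These coset sums must vanish for F(y+e) = F(y) + g(y) to be solvable; [integrable] asks that
    there be no other obstruction. *)
Definition esum g (y : A) : RmodZ R := \sum_(i < n.+1) g (y + e *+ i).

Lemma esum_shift g y : esum (fun y => g (y + e)) y = esum g y.
Proof.
rewrite /esum big_ord_recr big_ord_recl /= addr0 -addrA -mulrSr e_order addr0.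
rewrite addrC; congr (_ + _); apply: eq_bigr => i _.
by rewrite -addrA -mulrSr.
Qed.

Lemma esumDe g y : esum g (y + e) = esum g y.
Proof. by rewrite -[RHS]esum_shift; apply: eq_bigr => i _; rewrite addrAC. Qed.

Hypothesis integrable : forall g : A -> RmodZ R, (forall y, esum g y = 0) ->
  exists F : A -> RmodZ R, forall y, F (y + e) = F y + g y.

(** A choice of representatives of the cosets of <e>. The coset of 0 is represented by e and not by
    0, so that the gauge function of [kill_middle] vanishes when its first argument is e. *)
Variable r : A -> A.
Hypothesis r_e : r e = e.
Hypothesis r_shift : forall x, exists i, r x = x + e *+ i.
Hypothesis r_per : forall x, r (x + e) = r x.

Lemma per_r (T : Type) (F : A -> T) : (forall x, F (x + e) = F x) -> forall x, F (r x) = F x.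
Proof.
move=> Fe x; have [i ->] := r_shift x.
by elim: i => [|i IH]; rewrite ?addr0 // mulrSr addrA Fe.
Qed.

Lemma esum_per g y : (forall y, g (y + e) = g y) -> esum g y = g y *+ n.+1.
Proof.
move=> ge; rewrite /esum -[in RHS](card_ord n.+1) -sumr_const; apply: eq_bigr => i _.
by elim: (val i) => [|j IH]; rewrite ?addr0 // mulrSr addrA ge.
Qed.

Lemma kill_assoc w c : abelian_3cocycle w c -> (forall x, c x x = 0) ->
  exists f, forall x y, w x y e - dassoc f x y e = 0.
Proof.
move=> [Ha Hb Hc] c0.
pose h x y := esum (fun y => w x y e) y.
(* The sums [h x y] obstruct the recursion for [f x] along the coset of [y]. They satisfy
   [h x y = k (x + y) - k y] with [k] constant on cosets, since [k e = - n q(e) = 0], so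
   dividing [k] by the order of [e] yields the correction [g]. *)
have h_cocycle x y z : h y z - h (x + y) z + h x (y + z) = 0.
  have S1 : esum (fun z => w x y (z + e)) z = esum (fun z => w x y z) z by exact: esum_shift.
  have : h y z - h (x + y) z + h x (y + z) - esum (fun z => w x y (z + e)) z
         + esum (fun z => w x y z) z = 0.
    rewrite /h /esum -!sumrB -!big_split /= -sumrB -big_split /= big1 // => i _.
    by rewrite -(addrA y z) Ha.
  by rewrite S1 => H; apply: (eqr_comb H); zmod.
pose k x := h x 0.
have hE x y : h x y = k (x + y) - k y.
  by have := h_cocycle x y 0; rewrite !addr0 => H; apply: (eqr_comb H); rewrite /k; zmod.
have k0 : k 0 = 0 by rewrite {1}/k hE addr0 subrr.
(* In hexagon (b) at (e,y,e) two associator terms cancel, which leaves w(e,y,e) as a difference of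
   values of c(e,.), and these telescope around the coset. *)
have ke : k e = 0.
  have S1 : esum (fun y => c e (y + e)) 0 = esum (fun y => c e y) 0 by exact: esum_shift.
  have : k e - esum (fun y => c e (y + e)) 0 + esum (fun y => c e y) 0 = 0.
    rewrite /k /h /esum -!sumrB -!big_split /= big1 // => i _.
    by have H := Hb e (0 + e *+ i) e; rewrite c0 in H; apply: (eqr_comb H); zmod.
  by rewrite S1 => H; apply: (eqr_comb H); zmod.
have k_per x : k (x + e) = k x.
  have : h x e = h x 0 by rewrite -[h x 0]esumDe add0r.
  by rewrite !hE addr0 ke k0 => H; apply: (eqr_comb H); zmod.
have [half halfK] := RmodZ_divisible R n.
pose g y := - half (k y).
have g_per y : g (y + e) = g y by rewrite /g k_per.
have esumg y : esum g y = - k y by rewrite esum_per // mulNrn halfK.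
(* The normalisation F(e) = g(x) makes f(y,e) = g(y), so the terms in g of the recursion cancel
   those of [dassoc f x y e]. Their coset sum also cancels that of w(x,y,e), as [esum g] is - k. *)
have solve x : exists F : A -> RmodZ R,
    (forall y, F (y + e) = F y + (w x y e - g y + g (x + y))) /\ F e = g x.
  have [F FE] : exists F : A -> RmodZ R, forall y, F (y + e) = F y + (w x y e - g y + g (x + y)).
    apply: integrable => y.
    have -> : esum (fun y => w x y e - g y + g (x + y)) y = h x y - esum g y + esum g (x + y).
      by rewrite /h /esum -!sumrB -!big_split /=; apply: eq_bigr => i _; rewrite addrA.
    by rewrite !esumg hE; zmod.
  exists (fun y => F y - F e + g x); split=> [y|]; last by zmod.
  by rewrite FE; zmod.
have [f fP] := choice solve.
exists f => x y; have [f1 _] := fP x; rewrite /dassoc f1.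
have [_ f2] := fP y; have [_ f3] := fP (x + y).
by rewrite f2 f3; zmod.
Qed.

(** A gauge function supported on the row x = e suffices. It enters [dassoc f x y e] only through
    f(e,y+e) - f(e,y), and this is zero because hexagon (c) at (y,e,e) makes c(.,e) periodic. *)
Lemma kill_braid w c : abelian_3cocycle w c -> (forall x, c x x = 0) ->
  (forall x y, w x y e = 0) ->
  exists f, (forall x y, dassoc f x y e = 0) /\ (forall x, c x e - dbraid f x e = 0).
Proof.
move=> [Ha Hb Hc] c0 we.
have c_per y : c (y + e) e = c y e.
  have H := Hc y e e; rewrite c0 !we in H.
  by apply: (eqr_comb (eqrN2 H)); zmod.
exists (fun x y => if x == e then - c y e else 0).
have fe x : (if x == e then - c e e else 0) = 0 :> RmodZ R by rewrite c0 oppr0 if_same.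
split=> [x y|x].
- rewrite /dassoc !fe; case: eqP => _; last by zmod.
  by rewrite c_per; zmod.
- rewrite /dbraid eqxx; case: eqP => [->|_]; first by rewrite c0; zmod.
  zmod.
Qed.

(* The obstruction to killing [w x e y] by a function periodic in [y] is a sum of [w y e x]
   over a coset of [e], which telescopes because [c x (y + e) = c x y + w y e x]. *)
Lemma kill_middle w c : abelian_3cocycle w c -> (forall x, c x x = 0) ->
  (forall x y, w x y e = 0) -> (forall x, c x e = 0) ->
  exists f, [/\ forall x y, dassoc f x y e = 0, forall x y, w x e y - dassoc f x e y = 0
              & forall x, dbraid f x e = 0].
Proof.
move=> wc c0 we ce; have asym := braid_antisym wc c0; have [Ha Hb Hc] := wc.
have ec x : c e x = 0 by rewrite asym ce oppr0.
have w_per x y z : w x y (z + e) = w x y z.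
  have H := Ha x y z e; rewrite !we in H; apply: (eqr_comb (eqrN2 H)); zmod.
have cr x y : c y (x + e) = c y x + w x e y.
  have H := Hb y x e; rewrite ce !we in H; apply: (eqr_comb (eqrN2 H)); zmod.
have cl x y : c (y + e) x = c y x - w y e x.
  have H := Hc y e x; rewrite ec !we in H; apply: (eqr_comb (eqrN2 H)); zmod.
(* The summand - c(y,x) alone gives f(x,y) - f(x+e,y) = w(x,e,y). The summand c(y,r x) is periodic
   in x and restores both periodicity in y and vanishing at x = e. *)
pose f x y := c y (r x) - c y x.
have f_per x y : f x (y + e) = f x y.
  have ur : w y e (r x) = w y e x by apply: (per_r (F := w y e)).
  by rewrite /f !cl ur; zmod.
have fe x : f x e = 0 by rewrite /f !ec; zmod.
have ef x : f e x = 0 by rewrite /f r_e; zmod.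
exists f; split=> [x y|x y|x].
- by rewrite /dassoc !fe f_per; zmod.
- rewrite /dassoc ef fe (addrC e) f_per /f r_per cr; zmod.
- by rewrite /dbraid fe ef; zmod.
Qed.

Lemma reduce w c : abelian_3cocycle w c -> (forall x, c x x = 0) ->
  exists w' c', [/\ abelian_3cocycle w' c', forall x, c' x x = 0,
      coboundary w' c' -> coboundary w c
    & [/\ forall x y z, w' (r x) (r y) (r z) = w' x y z & forall x y, c' (r x) (r y) = c' x y]].
Proof.
move=> wc c0.
have sub0 c1 f : (forall x, c1 x x = 0) -> forall x, c1 x x - dbraid f x x = 0 :> RmodZ R.
  by move=> c10 x; rewrite c10 /dbraid; zmod.
have [f1 f1P] := kill_assoc wc c0.
have wc1 := cocycle_sub wc (dcocycle f1); have c01 := sub0 c f1 c0.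
have [f2 [f2w f2c]] := kill_braid wc1 c01 f1P.
have wc2 := cocycle_sub wc1 (dcocycle f2); have c02 := sub0 (fun x y => c x y - dbraid f1 x y) f2 c01.
have [|//|f3 [f3w f3m f3c]] := kill_middle wc2 c02.
  by move=> x y; rewrite f1P f2w subr0.
have wc3 := cocycle_sub wc2 (dcocycle f3); have c03 :=
  sub0 (fun x y => c x y - dbraid f1 x y - dbraid f2 x y) f3 c02.
set w3 := (fun x y z => _) in wc3; set c3 := (fun x y => _) in wc3 c03.
have we x y : w3 x y e = 0 by rewrite /w3 f1P f2w f3w !subr0.
have wm x y : w3 x e y = 0 by rewrite /w3 f3m.
have ce x : c3 x e = 0 by rewrite /c3 f3c f2c subr0.
have asym := braid_antisym wc3 c03; have [Ha Hb Hc] := wc3.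
have ec x : c3 e x = 0 by rewrite asym ce oppr0.
(* Hexagon (b) at (e,x,y) gives vanishing in the remaining slot; the periodicities of [w3] are then
   pentagons with e in one slot. *)
have ew x y : w3 e x y = 0.
  by have H := Hb e x y; rewrite !ec we wm in H; apply: (eqr_comb H); zmod.
have w_per1 x y z : w3 (x + e) y z = w3 x y z.
  by have H := Ha e x y z; rewrite !ew (addrC e) in H; apply: (eqr_comb (eqrN2 H)); zmod.
have w_per3 x y z : w3 x y (z + e) = w3 x y z.
  by have H := Ha x y z e; rewrite !we in H; apply: (eqr_comb (eqrN2 H)); zmod.
have w_per2 x y z : w3 x (y + e) z = w3 x y z.
  by have H := Ha x y e z; rewrite !wm we (addrC e) w_per3 in H; apply: (eqr_comb H); zmod.
have c_per2 x y : c3 x (y + e) = c3 x y.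
  by have H := Hb x y e; rewrite ce !we wm in H; apply: (eqr_comb (eqrN2 H)); zmod.
have c_per1 x y : c3 (x + e) y = c3 x y by rewrite asym c_per2 -asym.
exists w3, c3; split=> //.
- by move=> /coboundary_sub /coboundary_sub /coboundary_sub.
- split=> [x y z|x y].
  + rewrite (per_r (F := fun x => w3 x (r y) (r z))) //.
    by rewrite (per_r (F := fun y => w3 x y (r z))) // (per_r (F := w3 x y)).
  + by rewrite (per_r (F := fun x => c3 x (r y))) // (per_r (F := c3 x)).
Qed.

End Reduction.

(* The injectivity half of the Eilenberg-MacLane theorem: an abelian 3-cocycle is
   a coboundary as soon as its quadratic form vanishes. *)
Definition qform_faithful (R : realType) (A : zmodType) : Prop :=
  forall (w : A -> A -> A -> RmodZ R) (c : A -> A -> RmodZ R),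
    abelian_3cocycle w c -> (forall x, c x x = 0) -> coboundary w c.

(** * Induction over cyclic factors *)

Lemma cocycle_pullback (R : realType) (A B : zmodType) (h : B -> A)
    (w : A -> A -> A -> RmodZ R) (c : A -> A -> RmodZ R) :
  {morph h : x y / x + y} -> abelian_3cocycle w c ->
  abelian_3cocycle (fun x y z => w (h x) (h y) (h z)) (fun x y => c (h x) (h y)).
Proof. by move=> hD [Ha Hb Hc]; split=> *; rewrite !hD. Qed.

Lemma cohomologous_pullback (R : realType) (A B : zmodType) (h : B -> A)
    (w w' : A -> A -> A -> RmodZ R) (c c' : A -> A -> RmodZ R) :
  {morph h : x y / x + y} -> cohomologous w c w' c' ->
  cohomologous (fun x y z => w (h x) (h y) (h z)) (fun x y => c (h x) (h y))
               (fun x y z => w' (h x) (h y) (h z)) (fun x y => c' (h x) (h y)).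
Proof.
move=> hD [f [fw fc]]; exists (fun x y => f (h x) (h y)).
by split=> *; rewrite ?hD ?fw ?fc.
Qed.

Lemma eq_cohomologous (R : realType) (A : zmodType)
    (w1 w2 w1' w2' : A -> A -> A -> RmodZ R) (c1 c2 c1' c2' : A -> A -> RmodZ R) :
  (forall x y z, w1 x y z = w1' x y z) -> (forall x y, c1 x y = c1' x y) ->
  (forall x y z, w2 x y z = w2' x y z) -> (forall x y, c2 x y = c2' x y) ->
  cohomologous w1 c1 w2 c2 -> cohomologous w1' c1' w2' c2'.
Proof.
move=> ew1 ec1 ew2 ec2 [f [fw fc]]; exists f.
by split=> *; rewrite -?ew1 -?ew2 -?ec1 -?ec2 ?fw ?fc.
Qed.

Lemma can_morphD (A B : zmodType) (g : A -> B) (h : B -> A) :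
  {morph g : x y / x + y} -> cancel g h -> cancel h g -> {morph h : x y / x + y}.
Proof. by move=> gD gK hK x y; rewrite -[RHS]gK gD !hK. Qed.

Lemma qform_faithful_bij (R : realType) (A B : zmodType) (g : A -> B) :
  {morph g : x y / x + y} -> bijective g -> qform_faithful R A -> qform_faithful R B.
Proof.
move=> gD [h gK hK] emA w c wc c0; have hD := can_morphD gD gK hK.
have := emA _ _ (cocycle_pullback gD wc) (fun x => c0 _).
by move=> /(cohomologous_pullback hD); apply: eq_cohomologous => *; rewrite ?hK.
Qed.

Lemma qform_faithful_unit (R : realType) : qform_faithful R 'I_1.
Proof.
move=> w c [Ha _ _] c0; exists (fun _ _ => 0); split=> [x y z|x y].
- have := Ha 0 0 0 0; rewrite !addr0 (ord1 x) (ord1 y) (ord1 z) => H.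
  by apply: (eqr_comb H); zmod.
- by rewrite (ord1 x) (ord1 y) (c0 ord0) !subr0.
Qed.

Lemma qform_faithful_prod (R : realType) (B : zmodType) (n : nat) :
  qform_faithful R B -> qform_faithful R (B * 'I_n.+1)%type.
Proof.
move=> emB w c wc c0.
pose A : zmodType := (B * 'I_n.+1)%type.
pose e : A := (0, Zp1); pose r (x : A) : A := (x.1, Zp1); pose s (x : A) : A := (x.1, 0).
have eMn i : e *+ i = (0, inZp i) :> A.
  elim: i => [|i IH]; first by rewrite mulr0n; congr pair; apply: val_inj.
  rewrite mulrSr IH; congr pair; first exact: addr0.
  by apply: val_inj; rewrite /= modnDm addn1.
have eE (x : A) : s x + e *+ x.2 = x.
  case: x => b j; rewrite eMn; congr pair; first exact: addr0.
  by rewrite /= valZpK; apply: add0r.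
have e_order : e *+ n.+1 = 0 by rewrite eMn; congr pair; apply: val_inj; rewrite /= modnn.
have r_e : r e = e by [].
have r_per x : r (x + e) = r x by rewrite /r; congr pair; apply: addr0.
have r_s x : r (s x) = r x by [].
have r_shift x : exists i, r x = x + e *+ i.
  (* The first n.+1 - x.2 steps bring the second coordinate to 0, one more brings it to [Zp1]. *)
  exists (n.+1 - x.2 + 1)%N; rewrite -{2}(eE x) -addrA -mulrnDr.
  have -> : (x.2 + (n.+1 - x.2 + 1) = n.+1 + 1)%N by rewrite addnA subnKC // ltnW.
  by rewrite mulrnDr e_order add0r; congr pair; rewrite ?addr0 ?add0r.
(* The solution is the partial sum of g along the coset, started at second coordinate 0. The
   recursion is at stake only at the wrap-around y.2 = n, where it asks for the full coset sum to
   vanish. *)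
have integrable (g : A -> RmodZ R) : (forall y, esum e n g y = 0) ->
    exists F : A -> RmodZ R, forall y, F (y + e) = F y + g y.
  move=> g0; exists (fun y : A => \sum_(i < nat_of_ord y.2) g (s y + e *+ i)) => y.
  have sD : s (y + e) = s y by rewrite /s; congr pair; apply: addr0.
  have gy : g y = g (s y + e *+ y.2) by rewrite eE.
  have -> : \sum_(i < y.2) g (s y + e *+ i) + g y = \sum_(i < y.2.+1) g (s y + e *+ i).
    by rewrite gy big_ord_recr.
  rewrite sD.
  have [lt|] := ltnP y.2 n.
    by have -> : nat_of_ord (y + e).2 = y.2.+1 by rewrite /= modnDmr addn1 modn_small.
  have := ltn_ord y.2; rewrite ltnS => le1 le2.
  have yn : y.2 = n :> nat by apply/eqP; rewrite eqn_leq le1 le2.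
  have -> : nat_of_ord (y + e).2 = 0%N by rewrite /= modnDmr yn addn1 modnn.
  by rewrite yn big_ord0 [RHS]g0.
have [w' [c' [wc' c0' cob [w'r c'r]]]] := reduce e_order integrable r_e r_shift r_per wc c0.
(* Restriction to B x 0 followed by pullback along the first projection gives back w' and c', since
   r forgets the second coordinate. *)
apply: cob; pose i (x : B) : A := (x, 0).
have iD : {morph i : x y / x + y} by move=> x y; congr pair; rewrite /= ?addr0.
have fD : {morph (fun x : A => x.1) : x y / x + y} by [].
have := emB _ _ (cocycle_pullback iD wc') (fun x => c0' _).
move=> /(cohomologous_pullback fD); apply: eq_cohomologous => // [x y z|x y].
- by rewrite -w'r -[RHS]w'r.
- by rewrite -c'r -[RHS]c'r.
Qed.

Lemma qform_faithful_ord (R : realType) (n : nat) : qform_faithful R 'I_n.+1.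
Proof.
apply: (@qform_faithful_bij R ('I_1 * 'I_n.+1)%type _ (fun x => x.2)) => //.
  exists (fun x => (0, x)) => [[x y]|] //=; by rewrite (ord1 x).
exact/qform_faithful_prod/qform_faithful_unit.
Qed.

(** The isometry goes from D' to D because D' will be a model, mapped into D by choosing images of
    its generators; the difference of the two cocycles is then taken on the model, where
    faithfulness is known. *)
Lemma equivalent_of_qform (R : realType) (D D' : abelian_datum R) (g : D' -> D) :
  {morph g : x y / x + y} -> bijective g -> (forall x, qform (g x) = qform x) ->
  qform_faithful R D' -> is_abelian_theory D -> is_abelian_theory D' ->
  equivalent D D'.
Proof.
move=> gD [h gK hK] gq em' wc wc'; have hD := can_morphD gD gK hK.
have hB : zmod_morphism h.
  move=> x y; apply: (addIr (h y)); rewrite -hD !subrK //.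
pose hm := GRing.isZmodMorphism.Build D D' h hB.
pose ha : {additive D -> D'} := HB.pack h hm.
exists ha; split; first by exists g.
have := em' _ _ (cocycle_sub wc' (cocycle_pullback gD wc)).
case=> [x|f [fw fc]]; first by have := gq x; rewrite /qform => ->; rewrite subrr.
exists (fun x y => f (h x) (h y)); split=> [x y z|x y].
- by rewrite !hD -fw !hK subr0.
- by rewrite -fc !hK subr0.
Qed.

Lemma qform_of_equivalent (R : realType) (D D' : abelian_datum R) :
  equivalent D D' -> exists f : {additive D -> D'},
    bijective f /\ forall x, qform (f x) = qform x.
Proof.
move=> [f [fbij [g [_ gc]]]]; exists f; split=> // x.
by apply/eqP; rewrite -subr_eq0 gc subrr.
Qed.

(** * Quadratic forms with values in R/Z *)

Definition fr (R : realType) (N : nat) (a : int) : RmodZ R := modZ (a%:~R / N%:R).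

Section Fractions.
Variable R : realType.
Implicit Types (N m n : nat) (a b : int).
Local Notation fr := (fr R).

Lemma frD N a b : fr N (a + b) = fr N a + fr N b.
Proof. by rewrite /fr rmorphD mulrDl raddfD. Qed.

Lemma fr0 N : fr N 0 = 0.
Proof. by rewrite /fr mul0r raddf0. Qed.

Lemma frN N a : fr N (- a) = - fr N a.
Proof. by rewrite /fr rmorphN mulNr raddfN. Qed.

Lemma frB N a b : fr N (a - b) = fr N a - fr N b.
Proof. by rewrite frD frN. Qed.

Lemma frMz N a b : fr N a *~ b = fr N (a * b).
Proof. by rewrite /fr -raddfMz /= -mulrzr rmorphM mulrAC. Qed.

Lemma frMn N a m : fr N a *+ m = fr N (a * m%:Z).
Proof. by rewrite -frMz. Qed.

Lemma fr_eq0 N a : (0 < N)%N -> (fr N a == 0) = (N%:Z %| a)%Z.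
Proof.
move=> N0; have N0r : (N%:R : R) != 0 by rewrite pnatr_eq0 -lt0n.
rewrite modZ_eq0; apply/intrP/dvdzP => [[m E]|[m ->]]; exists m.
- apply: (@intr_inj R); rewrite rmorphM /= -E.
  by rewrite -[_%:Z%:~R]/(N%:R) divfK.
- by rewrite rmorphM; apply: mulfK.
Qed.

Lemma fr_eq N a b : (0 < N)%N -> (fr N a == fr N b) = (N%:Z %| a - b)%Z.
Proof. by move=> N0; rewrite -subr_eq0 -frB fr_eq0. Qed.

Lemma fr_mul N m a : (0 < m)%N -> fr (m * N) (m%:Z * a) = fr N a.
Proof.
move=> m0; have m0r : (m%:R : R) != 0 by rewrite pnatr_eq0 -lt0n.
rewrite /fr rmorphM natrM /= -[_%:Z%:~R]/(m%:R) invfM mulrACA divff // mul1r //.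
Qed.

Lemma fr_surj N (x : RmodZ R) : (0 < N)%N -> x *+ N = 0 -> exists a, x = fr N a.
Proof.
move=> N0; have N0r : (N%:R : R) != 0 by rewrite pnatr_eq0 -lt0n.
have [t <-] := modZ_surj x; rewrite -raddfMn => /eqP; rewrite modZ_eq0 => /intrP[a E].
by exists a; rewrite /fr -E -[t *+ N]mulr_natr mulfK.
Qed.

Lemma fr_pos N a : (0 < N)%N -> exists u : nat, (0 < u)%N /\ fr N a = fr N u.
Proof.
move=> N0; exists (`|(a %% N)%Z|%N + N)%N; split; first by rewrite addn_gt0 N0 orbT.
apply/eqP; rewrite fr_eq //; apply/dvdzP; exists ((a %/ N)%Z - 1).
rewrite PoszD gez0_abs ?modz_ge0 //; last by rewrite -lt0n.
by rewrite {1}(divz_eq a N); ring.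
Qed.

End Fractions.

Section QuadraticForm.
Variables (R : realType) (D : abelian_datum R).
Hypothesis thD : is_abelian_theory D.
Implicit Types x y z : D.

Lemma bformE x y : bform x y = polar (@braid R D) x y.
Proof. by rewrite /bform /qform (cocycle_diagD thD); zmod. Qed.

Lemma bformC x y : bform x y = bform y x.
Proof. by rewrite !bformE /polar addrC. Qed.

Lemma bformDl x y z : bform (x + y) z = bform x z + bform y z.
Proof. by rewrite !bformE (polarDl thD). Qed.

Lemma bformDr x y z : bform z (x + y) = bform z x + bform z y.
Proof. by rewrite !(bformC z) bformDl. Qed.

Lemma bform_zmod z : zmod_morphism (fun x => bform x z).
Proof. by move=> x y; apply: (addIr (bform y z)); rewrite -bformDl !subrK. Qed.

Lemma bformMzl x y (m : int) : bform (x *~ m) y = bform x y *~ m.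
Proof.
pose f : {additive D -> RmodZ R} := HB.pack (fun x => bform x y)
  (GRing.isZmodMorphism.Build D (RmodZ R) (fun x => bform x y) (bform_zmod y)).
exact: (raddfMz f m x).
Qed.

Lemma bformMzr x y (m : int) : bform x (y *~ m) = bform x y *~ m.
Proof. by rewrite bformC bformMzl bformC. Qed.

Lemma bform0l x : bform 0 x = 0.
Proof. by rewrite -(mulr0z x) bformMzl mulr0z. Qed.

Lemma bformxx x : bform x x = qform x *+ 2.
Proof. by rewrite bformE. Qed.

Lemma qformD x y : qform (x + y) = qform x + qform y + bform x y.
Proof. by rewrite /bform; zmod. Qed.

Lemma qform0 : qform (0 : D) = 0.
Proof. by have := bform0l 0; rewrite /bform addr0 => H; apply: (eqr_comb (eqrN2 H)); zmod. Qed.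

Lemma qformMz x (m : int) : qform (x *~ m) = qform x *~ (m * m).
Proof.
have nat_case n : qform (x *+ n) = qform x *+ (n * n).
  elim: n => [|n IH]; first by rewrite mulr0n qform0.
  rewrite mulrSr qformD IH -[x *+ n]/(x *~ n) bformMzl bformxx.
  rewrite -[_ *~ n]/(_ *+ n) -mulrnA -mulrSr -mulrnDr; congr (_ *+ _); lia.
case: m => n; first exact: nat_case.
rewrite NegzE mulrNz -[x *~ _]/(x *+ n.+1).
have qN y : qform (- y) = qform y.
  have := bformMzl y y (-1); rewrite mulrNz mulr1z mulrNz mulr1z bformxx mulr2n.
  by rewrite /bform addNr qform0 => H; apply: (eqr_comb (eqrN2 H)); zmod.
by rewrite qN nat_case mulrNN.
Qed.

Lemma qform_comb x y (s t : int) :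
  qform (x *~ s + y *~ t) = qform x *~ (s * s) + qform y *~ (t * t) + bform x y *~ (s * t).
Proof. by rewrite qformD !qformMz bformMzr bformMzl -mulrzA. Qed.

End QuadraticForm.

(** * Generators and frames of a prime theory *)

Lemma coprime_odd_prime (p : nat) : prime p -> p <> 2%N -> coprime p 2.
Proof. by move=> pp /eqP p2; rewrite prime_coprime // dvdn_prime2. Qed.

Lemma prime_exp_gt1 (p k : nat) : prime p -> (0 < k)%N -> (1 < p ^ k)%N.
Proof. by move=> pp k0; rewrite -(exp1n k) ltn_exp2r ?prime_gt1. Qed.

Lemma coprimez_pX (p k : nat) (d : int) :
  prime p -> ~~ (p%:Z %| d)%Z -> coprimez (p ^ k)%N d.
Proof.
by move=> pp nd; rewrite coprimezE; apply: coprimeXl; rewrite prime_coprime.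
Qed.

Lemma mulrn_Zp (A : zmodType) (x : A) (N : nat) : (1 < N)%N -> x *+ N = 0 ->
  {morph (fun z : 'Z_N => x *+ z) : a b / a + b}.
Proof.
move=> N1 xN a b; rewrite /= [X in (_ %% X)%N]Zp_cast // -mulrnDr.
by rewrite [in RHS](divn_eq (a + b) N) mulrnDr mulnC mulrnA xN mul0rn add0r.
Qed.

Lemma ltn_Zp (N : nat) (z : 'Z_N) : (1 < N)%N -> (z < N)%N.
Proof. by move=> N1; rewrite -[X in (_ < X)%N](Zp_cast N1) ltn_ord. Qed.

Lemma Zp_dvd_eq0 (N : nat) (z : 'Z_N) : (1 < N)%N -> (N%:Z %| (z : nat)%:Z)%Z -> z = 0.
Proof.
move=> N1; rewrite dvdzE /= => /dvdnP[[|m] E]; first exact: val_inj.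
by have := ltn_Zp z N1; rewrite E mulSn ltnNge leq_addr.
Qed.

Section Prime.
Variables (R : realType) (D : abelian_datum R).
Hypothesis primeD : is_prime_anyon_theory D.

Let thD : is_abelian_theory D. Proof. by case: primeD => [[]]. Qed.

(* A nondegenerate subgroup splits off as an orthogonal summand; in a prime theory
   it is therefore everything. *)
Lemma prime_onto (C : finZmodType) (g : C -> D) :
  {morph g : x y / x + y} -> (exists c : C, c != 0) ->
  (forall a, (forall b, bform (g a) (g b) = 0) -> a = 0) -> bijective g.
Proof.
move=> gD [c0 c0n0] nd; case: primeD => _ _ pr.
have g0 : g 0 = 0 by apply: (addrI (g 0)); rewrite -gD !addr0.
have gB a b : g (a - b) = g a - g b.
  by apply: (addIr (g b)); rewrite -gD !subrK.
have g_inj : injective g.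
  move=> a b E; apply/subr0_eq/nd => c.
  by rewrite gB E subrr (bform0l thD).
apply: inj_card_bij => //.
have gs : group_set (g @: [set: C]).
  apply/group_setP; split=> [|_ _ /imsetP[a _ ->] /imsetP[b _ ->]].
    by rewrite FinRing.zmod1gE -g0 imset_f.
  by rewrite FinRing.zmodMgE -gD imset_f.
pose B := Group gs.
have nB : nondegenerate_on B.
  move=> _ /imsetP[a _ ->] H; rewrite (nd a) // => b; apply: H.
  by apply/imsetP; exists b.
have : ~~ (B \proper [set: D]).
  apply/negP => /(pr B); apply; last exact: nB.
  apply/eqP => /(congr1 (fun H : {group D} => g c0 \in H)).
  rewrite (_ : (g c0 \in B) = true); last by apply/imsetP; exists c0.
  move=> /esym/set1gP; rewrite FinRing.zmod1gE => E; move/eqP: c0n0; apply.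
  by apply: g_inj; rewrite g0.
rewrite properE subsetT /= negbK => /subset_leq_card.
by rewrite cardsT => /leq_trans; apply; rewrite card_imset // cardsT.
Qed.

Lemma prime_cyclic (N : nat) (v : D) (w : int) :
  (1 < N)%N -> v *+ N = 0 -> bform v v = fr R N w -> coprimez N w ->
  bijective (fun z : 'Z_N => v *+ z).
Proof.
move=> N1 vN bv cop; have N0 := ltnW N1.
apply: (@prime_onto ('Z_N : finZmodType)); [exact: mulrn_Zp|by exists 1|].
move=> a /(_ 1); have -> : nat_of_ord (1 : 'Z_N) = 1%N by [].
rewrite mulr1n -[v *+ a]/(v *~ a%:Z) (bformMzl thD) bv frMz => /eqP.
by rewrite fr_eq0 // Gauss_dvdzr // => /(Zp_dvd_eq0 N1).
Qed.

(** As q(n x) = n^2 q(x), two forms on a cyclic group agree once they agree at a generator. *)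
Lemma cyclic_equivalent (N : nat) (v : D) (w : int)
    (om : 'Z_N -> 'Z_N -> 'Z_N -> RmodZ R) (c : 'Z_N -> 'Z_N -> RmodZ R)
    (D' := @AbelianDatum R 'Z_N om c) :
  (1 < N)%N -> v *+ N = 0 -> bform v v = fr R N w -> coprimez N w ->
  is_abelian_theory D' -> c 1 1 = qform v -> equivalent D D'.
Proof.
move=> N1 vN bv cop thD' c11.
apply: (@equivalent_of_qform R D D' (fun z : 'Z_N => v *+ z)) => //.
- exact: mulrn_Zp.
- exact: prime_cyclic bv cop.
- move=> x; rewrite -[v *+ x]/(v *~ x%:Z) (qformMz thD) -c11.
  have xE : x = (1 : D') *~ (x : nat)%:Z by rewrite -[RHS]/((1 : 'Z_N) *+ x) natr_Zp.
  by rewrite {3}xE (qformMz thD').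
- exact: qform_faithful_ord.
Qed.

End Prime.

(** * Pairs of elements and binary quadratic forms modulo 2^k *)

Section Frames.
Variables (R : realType) (D : abelian_datum R) (k : nat).
Hypothesis thD : is_abelian_theory D.

(** The integers are the coefficients of q(s x + t y) = (al s^2 + be t^2 + ga s t) / 2^k.
    Independence of x and y is left out: it follows from ga being odd. *)
Definition frame (al be ga : int) (x y : D) : Prop :=
  [/\ x *+ 2 ^ k = 0, y *+ 2 ^ k = 0, qform x = fr R (2 ^ k) al, qform y = fr R (2 ^ k) be
    & bform x y = fr R (2 ^ k) ga].

Lemma qform_frame (al be ga s t : int) (x y : D) : frame al be ga x y ->
  qform (x *~ s + y *~ t) = fr R (2 ^ k) (al * s * s + be * t * t + ga * s * t).
Proof.
by move=> [_ _ qx qy bxy]; rewrite (qform_comb thD) qx qy bxy !frMz !frD !mulrA.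
Qed.

Lemma bform_frame (al be ga s t s' t' : int) (x y : D) : frame al be ga x y ->
  bform (x *~ s + y *~ t) (x *~ s' + y *~ t') =
  fr R (2 ^ k) (2 * al * s * s' + 2 * be * t * t' + ga * (s * t' + s' * t)).
Proof.
move=> fxy; rewrite /bform.
have -> : x *~ s + y *~ t + (x *~ s' + y *~ t') = x *~ (s + s') + y *~ (t + t').
  by rewrite !mulrzDr addrACA.
by rewrite !(qform_frame _ _ fxy) -!frB; congr fr; ring.
Qed.

(** The Gram matrix of b has determinant 4 al be - ga^2, a unit modulo 2^k as ga is odd; the
    witnesses are Cramer's rule. *)
Lemma frame_indep (al be ga s t : int) (x y : D) : frame al be ga x y -> ~~ (2 %| ga)%Z ->
  bform (x *~ s + y *~ t) x = 0 -> bform (x *~ s + y *~ t) y = 0 ->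
  ((2 ^ k)%N%:Z %| s)%Z /\ ((2 ^ k)%N%:Z %| t)%Z.
Proof.
move=> fxy odd_ga; have N0 : (0 < 2 ^ k)%N by rewrite expn_gt0.
have := bform_frame s t 1 0 fxy; rewrite mulr1z mulr0z addr0 => ->.
have := bform_frame s t 0 1 fxy; rewrite mulr1z mulr0z add0r => ->.
move=> /eqP; rewrite fr_eq0 // => /dvdzP[m Em] /eqP; rewrite fr_eq0 // => /dvdzP[n En].
have cop : coprimez (2 ^ k)%N (4 * al * be - ga * ga).
  apply: coprimez_pX => //; apply: contra odd_ga => /dvdzP[j Ej].
  have : (2 %| ga * ga)%Z by apply/dvdzP; exists (2 * al * be - j); lia.
  by rewrite !dvdzE abszM Euclid_dvdM // orbb.
split; rewrite -(Gauss_dvdzr _ cop); apply/dvdzP.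
- exists (2 * be * m - ga * n); apply: (eqr_comb (eqrD2 (congr1 ( *%R (2 * be)) Em)
    (eqrN2 (congr1 ( *%R ga) En)))); ring.
- exists (2 * al * n - ga * m); apply: (eqr_comb (eqrD2 (congr1 ( *%R (2 * al)) En)
    (eqrN2 (congr1 ( *%R ga) Em)))); ring.
Qed.

End Frames.

Lemma pow2_gt1 (k : nat) : (0 < k)%N -> (1 < 2 ^ k)%N.
Proof. exact: prime_exp_gt1. Qed.

Lemma Z2k2_decomp (k : nat) (z : Z2k2 k) : z = e1 k *+ z.1 + e2 k *+ z.2.
Proof.
case: z => a b; congr pair.
- by rewrite /= !(raddfMn fst) /= natr_Zp mul0rn addr0.
- by rewrite /= !(raddfMn snd) /= natr_Zp mul0rn add0r.
Qed.

Section FrameMap.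
Variables (R : realType) (D : abelian_datum R) (k : nat).
Hypotheses (thD : is_abelian_theory D) (k0 : (0 < k)%N).
Implicit Types x y : D.

Definition frame_map x y (z : Z2k2 k) : D := x *+ z.1 + y *+ z.2.

Lemma frame_mapD x y : x *+ 2 ^ k = 0 -> y *+ 2 ^ k = 0 ->
  {morph frame_map x y : a b / a + b}.
Proof.
move=> xN yN a b; have N1 := pow2_gt1 k0.
by rewrite /frame_map (mulrn_Zp N1 xN a.1 b.1) (mulrn_Zp N1 yN a.2 b.2) addrACA.
Qed.

Lemma frame_map_eq0 al be ga x y (a : Z2k2 k) :
  frame k al be ga x y -> ~~ (2 %| ga)%Z ->
  bform (frame_map x y a) x = 0 -> bform (frame_map x y a) y = 0 -> a = 0.
Proof.
move=> fxy odd_ga; have N1 := pow2_gt1 k0.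
rewrite -[frame_map x y a]/(x *~ (a.1 : nat)%:Z + y *~ (a.2 : nat)%:Z) => Hx Hy.
have [/(Zp_dvd_eq0 N1) a1 /(Zp_dvd_eq0 N1) a2] := frame_indep thD fxy odd_ga Hx Hy.
by case: a a1 a2 {Hx Hy} => a1 a2 /= -> ->.
Qed.

Lemma frame_map_inj al be ga x y :
  frame k al be ga x y -> ~~ (2 %| ga)%Z -> injective (frame_map x y).
Proof.
move=> fxy odd_ga a b E; have [xN yN _ _ _] := fxy.
have gD := frame_mapD xN yN; apply: subr0_eq.
have g0 : frame_map x y (a - b) = 0.
  by apply: (addIr (frame_map x y b)); rewrite -gD subrK add0r.
by apply: (frame_map_eq0 fxy odd_ga); rewrite g0 (bform0l thD).
Qed.

End FrameMap.

Section PrimeFrames.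
Variables (R : realType) (D : abelian_datum R) (k : nat).
Hypotheses (primeD : is_prime_anyon_theory D) (k0 : (0 < k)%N).

Let thD : is_abelian_theory D. Proof. by case: primeD => [[]]. Qed.

Lemma prime_frame al be ga (x y : D) : frame k al be ga x y -> ~~ (2 %| ga)%Z ->
  bijective (frame_map (k := k) x y).
Proof.
move=> fxy odd_ga; have [xN yN _ _ _] := fxy; have N1 := pow2_gt1 k0.
have v1 : nat_of_ord (1 : 'Z_(2 ^ k)) = 1%N by [].
apply: (prime_onto primeD (C := Z2k2 k)); first exact: frame_mapD.
  by exists (e1 k); apply/eqP => /(congr1 fst).
move=> a Ha; apply: (frame_map_eq0 thD k0 fxy odd_ga).
- by have := Ha (e1 k); rewrite {2}/frame_map /= addr0.
- by have := Ha (e2 k); rewrite {2}/frame_map /= add0r.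
Qed.

Lemma frame_equivalent al be ga (x y : D)
    (om : Z2k2 k -> Z2k2 k -> Z2k2 k -> RmodZ R) (c : Z2k2 k -> Z2k2 k -> RmodZ R)
    (D' := @AbelianDatum R (Z2k2 k) om c) :
  frame k al be ga x y -> ~~ (2 %| ga)%Z -> is_abelian_theory D' ->
  @frame R D' k al be ga (e1 k) (e2 k) -> equivalent D D'.
Proof.
move=> fxy odd_ga thD' fD'; have [xN yN _ _ _] := fxy.
apply: (@equivalent_of_qform R D D' (@frame_map R D k x y)) => //.
- exact: frame_mapD.
- exact: prime_frame fxy odd_ga.
- move=> z; have zE : z = (e1 k : D') *~ (z.1 : nat)%:Z + (e2 k : D') *~ (z.2 : nat)%:Z.
    exact: Z2k2_decomp.
  rewrite {2}zE (qform_frame thD' _ _ fD').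
  by rewrite -[frame_map _ _ _]/(x *~ (z.1 : nat)%:Z + y *~ (z.2 : nat)%:Z) (qform_frame thD _ _ fxy).
- exact/qform_faithful_prod/qform_faithful_ord.
Qed.

End PrimeFrames.

Section FrameChange.
Variables (R : realType) (D : abelian_datum R) (k : nat).
Hypothesis thD : is_abelian_theory D.

Definition has_frame (al be ga : int) : Prop := exists x y : D, frame k al be ga x y.

Local Notation N := ((2 ^ k)%N%:Z).

Lemma has_frame_change al be ga s t s' t' al' be' ga' : has_frame al be ga ->
  (N %| al * s * s + be * t * t + ga * s * t - al')%Z ->
  (N %| al * s' * s' + be * t' * t' + ga * s' * t' - be')%Z ->
  (N %| 2 * al * s * s' + 2 * be * t * t' + ga * (s * t' + s' * t) - ga')%Z ->
  has_frame al' be' ga'.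
Proof.
move=> [x [y fxy]] Hal Hbe Hga; have [xN yN _ _ _] := fxy.
have N0 : (0 < 2 ^ k)%N by rewrite expn_gt0.
have kill (u v : int) : (x *~ u + y *~ v) *+ 2 ^ k = 0.
  rewrite mulrnDl -![_ *+ 2 ^ k]/(_ *~ (2 ^ k)%N) -!mulrzA ![_ * (2 ^ k)%N%:Z]mulrC !mulrzA.
  by rewrite -![_ *~ (2 ^ k)%N]/(_ *+ 2 ^ k) xN yN !mul0rz addr0.
exists (x *~ s + y *~ t), (x *~ s' + y *~ t'); split=> //.
- by rewrite (qform_frame thD _ _ fxy); apply/eqP; rewrite fr_eq.
- by rewrite (qform_frame thD _ _ fxy); apply/eqP; rewrite fr_eq.
- by rewrite (bform_frame thD _ _ _ _ fxy); apply/eqP; rewrite fr_eq.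
Qed.

End FrameChange.

(** * Normal forms over Z/2^k *)

Lemma inv_modz (N : nat) (a : int) : coprimez N a -> exists b, (N %| a * b - 1)%Z.
Proof.
rewrite /coprimez => /eqP g1; have [u [v E]] := Bezoutz N a.
by exists v; apply/dvdzP; exists (- u); rewrite g1 in E; rewrite -E; ring.
Qed.

Lemma oddzP (a : int) : ~~ (2 %| a)%Z -> exists m, a = 2 * m + 1.
Proof. by move=> oa; exists (a %/ 2)%Z; lia. Qed.

(* A root of the reduction mod 2 at which the derivative is odd lifts, by Newton's
   iteration [s' = s - P s]. *)
Lemma hensel2 (al be : int) (k : nat) : (2 %| be)%Z ->
  exists s, ((2 ^ k)%N %| al * s * s + s + be)%Z.
Proof.
move=> even_be; suff [s] : exists s, ((2 ^ k.+1)%N %| al * s * s + s + be)%Z.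
  by move=> Ps; exists s; apply: dvdz_trans Ps; rewrite dvdzE /= dvdn_exp2l.
elim: k => [|k [s]]; first by exists 0; rewrite mulr0 addr0 add0r.
set P := _ + be => dP; exists (s - P).
have PE : al * s * s + s + be = P by [].
clearbody P.
have -> : al * (s - P) * (s - P) + (s - P) + be = P * (al * (P - 2 * s)).
  by apply: (eqr_comb PE); ring.
rewrite expnSr PoszM; apply: dvdz_mul => //; apply: dvdz_mull.
apply: rpredB; last exact: dvdz_mulr.
by apply: dvdz_trans dP; rewrite dvdzE /= dvdn_exp.
Qed.

Section Normalisation.
Variables (R : realType) (D : abelian_datum R) (k : nat).
Hypotheses (thD : is_abelian_theory D) (k0 : (0 < k)%N).
Local Notation N := ((2 ^ k)%N%:Z).

Let dvd2N : (2 %| N)%Z. Proof. by rewrite dvdzE /= dvdn_exp. Qed.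

Lemma frame_swap al be ga : has_frame D k al be ga -> has_frame D k be al ga.
Proof.
move=> H; apply: (has_frame_change thD (s := 0) (t := 1) (s' := 1) (t' := 0) H);
  apply/dvdzP; exists 0; ring.
Qed.

Lemma frame_scale al be ga : has_frame D k al be ga -> ~~ (2 %| ga)%Z ->
  exists b, ~~ (2 %| b)%Z /\ has_frame D k al (be * b * b) 1.
Proof.
move=> H oga; have [//|b /dvdzP[q Eq]] := @inv_modz (2 ^ k) ga _.
  exact: coprimez_pX.
have /dvdzP[M EM] := dvd2N.
exists b; split.
  apply/negP => /dvdzP[m Em]; have [n En] := oddzP oga.
  have : 2 * (ga * m - q * M) = 1; last by lia.
  by apply: (eqr_comb Eq); rewrite EM Em; ring.
apply: (has_frame_change thD (s := 1) (t := 0) (s' := 0) (t' := b) H); apply/dvdzP.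
- by exists 0; ring.
- by exists 0; ring.
- by exists q; apply: (eqr_comb Eq); ring.
Qed.

(** With ga = 1 and be even, [hensel2] solves q(s x + y) = 0. This isotropic vector pairs with x to
    2 al s + 1, still odd; once it is rescaled to pair to 1, subtracting al times it from x makes x
    isotropic too. *)
Lemma frame_hyperbolic al be ga : has_frame D k al be ga -> ~~ (2 %| ga)%Z ->
  (2 %| be)%Z -> has_frame D k 0 0 1.
Proof.
move=> H oga ebe; have [b [_ H1]] := frame_scale H oga.
have [s /dvdzP[q Eq]] : exists s, (N %| al * s * s + s + be * b * b)%Z.
  by apply: hensel2; do 2!apply: dvdz_mulr.
have H2 : has_frame D k al 0 (2 * al * s + 1).
  apply: (has_frame_change thD (s := 1) (t := 0) (s' := s) (t' := 1) H1); apply/dvdzP.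
  - by exists 0; ring.
  - by exists q; apply: (eqr_comb Eq); ring.
  - by exists 0; ring.
have [|b' [_]] := frame_scale H2; first by lia.
rewrite !mul0r => H3.
apply: (has_frame_change thD (s := 1) (t := - al) (s' := 0) (t' := 1) H3);
  apply/dvdzP; exists 0; ring.
Qed.

Lemma frame_anisotropic al be ga : has_frame D k al be ga -> ~~ (2 %| ga)%Z ->
  ~~ (2 %| al)%Z -> ~~ (2 %| be)%Z -> has_frame D k 1 1 (-1).
Proof.
move=> H oga oal obe; have [b [ob H1]] := frame_scale H oga.
(* The equation q(s x + y) = 1 has an even constant term because be and b are odd. *)
have [s /dvdzP[q Eq]] : exists s, (N %| al * s * s + s + (be * b * b - 1))%Z.
  apply: hensel2; have [m ->] := oddzP obe; have [n ->] := oddzP ob.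
  by apply/dvdzP; exists (m * (2 * n + 1) * (2 * n + 1) + 2 * n * n + 2 * n); ring.
have H2 : has_frame D k 1 al (2 * al * s + 1).
  apply: (has_frame_change thD (s := s) (t := 1) (s' := 1) (t' := 0) H1); apply/dvdzP.
  - by exists q; apply: (eqr_comb Eq); ring.
  - by exists 0; ring.
  - by exists 0; ring.
have [|b' [ob' H3]] := frame_scale H2; first by lia.
set be' := al * b' * b' in H3.
have even_be' : (2 %| be' - 1)%Z.
  rewrite /be'; have [m ->] := oddzP oal; have [n ->] := oddzP ob'.
  by apply/dvdzP; exists (m * (2 * n + 1) * (2 * n + 1) + 2 * n * n + 2 * n); ring.
have [d /dvdzP[e Ee]] : exists d, (N %| (1 - 4 * be') * d - 1)%Z.
  by apply: inv_modz; apply: coprimez_pX => //; lia.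
(* q(m x + (1 - 2m) y) - 1 = (1 - 4 be')(m - m^2) + be' - 1; divided by the odd factor, this is an
   equation with even constant term. *)
have [m /dvdzP[f Ef]] : exists m, (N %| -1 * m * m + m + d * (be' - 1))%Z.
  by apply: hensel2; apply: dvdz_mull.
(* [x - 2 y] is orthogonal to [x], and adding multiples of it to [y] adjusts [qform y]. *)
have H4 : has_frame D k 1 1 1.
  apply: (has_frame_change thD (s := 1) (t := 0) (s' := m) (t' := 1 - 2 * m) H3); apply/dvdzP.
  - by exists 0; ring.
  - exists ((1 - 4 * be') * f - e * (be' - 1)).
    apply: (eqr_comb (eqrD2 (congr1 ( *%R (1 - 4 * be')) Ef)
      (eqrN2 (congr1 ( *%R (be' - 1)) Ee)))).
    ring.
  - by exists 0; ring.
(* Replacing y by -y changes the sign of the cross term to that of F_k. *)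
apply: (has_frame_change thD (s := 1) (t := 0) (s' := 0) (t' := -1) H4);
  apply/dvdzP; exists 0; ring.
Qed.

Lemma frame_normal al be ga : has_frame D k al be ga -> ~~ (2 %| ga)%Z ->
  has_frame D k 0 0 1 \/ has_frame D k 1 1 (-1).
Proof.
move=> H oga; case: (boolP (2 %| be)%Z) => [ebe|obe].
  by left; apply: frame_hyperbolic H oga ebe.
case: (boolP (2 %| al)%Z) => [eal|oal].
  by left; apply: frame_hyperbolic (frame_swap H) oga eal.
by right; apply: frame_anisotropic H oga oal obe.
Qed.

End Normalisation.

(** * The listed theories are prime *)

Lemma fr_primitive (R : realType) (p k : nat) (x : RmodZ R) :
  prime p -> (0 < k)%N -> x *+ p ^ k = 0 -> x *+ p ^ k.-1 <> 0 ->
  exists ga, x = fr R (p ^ k) ga /\ ~~ (p %| ga)%Z.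
Proof.
move=> pp k0 xN; have N0 : (0 < p ^ k)%N by rewrite expn_gt0 prime_gt0.
have [ga -> xn] := fr_surj N0 xN; exists ga; split=> //.
apply/negP => /dvdzP[m E]; apply: xn; apply/eqP; rewrite frMn fr_eq0 // E.
apply/dvdzP; exists m; rewrite -mulrA -PoszM -expnS prednK //.
Qed.

Lemma last_nonzero_multiple (A : zmodType) (p k : nat) (z : A) :
  z <> 0 -> z *+ p ^ k = 0 -> exists j, z *+ p ^ j <> 0 /\ z *+ p ^ j *+ p = 0.
Proof.
elim: k => [|k IH] zn0; first by rewrite expn0 mulr1n.
rewrite expnSr mulrnA => zk; case: (z *+ p ^ k =P 0) => [/(IH zn0) //|?].
by exists k.
Qed.

Lemma biadditive_theory (R : realType) (A : finZmodType) (c : A -> A -> RmodZ R) :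
  biadditive c -> is_abelian_theory (AbelianDatum (fun _ _ _ => 0) c).
Proof. by move=> [cl cr]; split=> [x y z t|x y z|x y z] /=; rewrite ?cl ?cr; zmod. Qed.

Lemma odd_datum_theory (R : realType) (p k u : nat) :
  (1 < p ^ k)%N -> is_abelian_theory (odd_datum R p k u).
Proof.
move=> N1; apply: biadditive_theory.
have N0 := ltnW N1.
have cE (x y : 'Z_(p ^ k)) :
    modZ ((u * x * y)%N%:R / (p ^ k)%N%:R) = fr R (p ^ k) u *+ x *+ y.
  by rewrite !frMn -!PoszM.
have uN : fr R (p ^ k) u *+ p ^ k = 0.
  by apply/eqP; rewrite frMn fr_eq0 // dvdz_mull.
split=> x y z; rewrite !cE.
- by rewrite (mulrn_Zp N1 uN) mulrnDl.
- by rewrite mulrn_Zp // mulrnAC uN mul0rn.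
Qed.

Lemma qform_odd_datum (R : realType) (p k u : nat) :
  @braid R (odd_datum R p k u) (1 : 'Z_(p ^ k)) (1 : 'Z_(p ^ k)) = fr R (p ^ k) u.
Proof. by rewrite /= !muln1. Qed.

Lemma two_datum_theory (R : realType) (k u : nat) :
  (0 < k)%N -> odd u -> is_abelian_theory (two_datum R k u).
Proof.
move=> k0 ou; have N1 := pow2_gt1 k0; have N0 := ltnW N1.
have NN0 : (0 < 2 ^ k.+1)%N by rewrite expn_gt0.
pose N : int := (2 ^ k)%N; pose N2 : int := (2 ^ k.+1)%N.
have N2E : N2 = 2 * N by rewrite /N2 expnS PoszM.
(* The carry of the addition of representatives, a symmetric 2-cocycle by [cyA]. The associator is N
   x cy(y,z) over the denominator 2N. *)
pose cy (x y : 'Z_(2 ^ k)) : int := (2 ^ k <= x + y)%N.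
have cyC x y : cy x y = cy y x by rewrite /cy addnC.
have addE (x y : 'Z_(2 ^ k)) : Posz (nat_of_ord (x + y)%R) = x%:Z + y%:Z - N * cy x y.
  rewrite /= [X in (_ %% X)%N]Zp_cast // /cy /N.
  have ltx := ltn_Zp x N1; have lty := ltn_Zp y N1.
  case: leqP => [le|lt]; last by rewrite modn_small // mulr0 subr0 PoszD.
  rewrite -[in LHS](subnK le) modnDr modn_small; last by lia.
  by rewrite -subzn // PoszD mulr1.
have cyA x y z : cy y z + cy x (y + z) = cy x y + cy (x + y) z.
  have Nn0 : N != 0 by rewrite /N -lt0n.
  apply: (mulfI Nn0); have := congr1 (fun a : 'Z_(2 ^ k) => Posz a) (addrA x y z).
  by rewrite !addE => E; apply: (eqr_comb (esym E)); ring.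
have cE (x y : 'Z_(2 ^ k)) :
    modZ ((u * x * y)%N%:R / (2 ^ k.+1)%N%:R) = fr R (2 ^ k.+1) (u%:Z * x%:Z * y%:Z).
  by rewrite -!PoszM.
have wE (x y z : 'Z_(2 ^ k)) :
    (if (2 ^ k <= y + z)%N then modZ ((x : nat)%:R / 2) else 0) =
    fr R (2 ^ k.+1) (N * x%:Z * cy y z).
  rewrite /cy; case: leqP => _; last by rewrite mulr0 fr0.
  by rewrite mulr1 expnSr fr_mul.
have [m um] : exists m : int, u%:Z = 2 * m + 1 by exists u./2%:Z; lia.
have [M EM] : exists M : int, N = 2 * M.
  by exists (2 ^ k.-1)%N; rewrite /N -{1}(prednK k0) expnS PoszM.
rewrite /is_abelian_theory.
have -> : @assoc R (two_datum R k u) = fun x y z => fr R (2 ^ k.+1) (N * x%:Z * cy y z).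
  by apply: funext => x; apply: funext => y; apply: funext => z; rewrite -wE.
have -> : @braid R (two_datum R k u) = fun x y => fr R (2 ^ k.+1) (u%:Z * x%:Z * y%:Z).
  by apply: funext => x; apply: funext => y; rewrite -cE.
(* The pentagon leaves N^2 times two carries, a multiple of 2N because N is even. In the hexagons, c
   fails to be bilinear by u N times a carry and the associator turns u into u + 1 or u - 1, even
   because u is odd. *)
split=> [x y z t|x y z|x y z]; rewrite ?addE -?frN -?frD; apply/eqP;
  rewrite fr_eq0 // -/N2 N2E; apply/dvdzP.
- exists (M * cy x y * cy z t).
  apply: (eqr_comb (eqrD2 (congr1 ( *%R (N * cy x y * cy z t)) EM)
    (eqrN2 (congr1 ( *%R (N * x%:Z)) (cyA y z t))))); ring.
- by exists (x%:Z * cy y z * (m + 1)); rewrite (cyC z x) um; ring.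
- by exists (z%:Z * cy x y * m); rewrite (cyC z y) um; ring.
Qed.

Section Models.
Variables (R : realType) (D : abelian_datum R).
Hypothesis thD : is_abelian_theory D.
Implicit Types B : {group D}.

Lemma groupMn B (x : D) n : x \in B -> x *+ n \in B.
Proof. by move=> xB; rewrite -FinRing.zmodXgE groupX. Qed.

Lemma groupMz B (x : D) (m : int) : x \in B -> x *~ m \in B.
Proof.
move=> xB; case: m => n; first exact: groupMn.
by rewrite NegzE mulrNz -FinRing.zmodVgE groupV; apply: groupMn.
Qed.

Lemma groupDz B (x y : D) : x \in B -> y \in B -> x + y \in B.
Proof. by move=> xB yB; rewrite -FinRing.zmodMgE groupM. Qed.

Lemma nondegenerate_witness B (a : D) : nondegenerate_on B -> a \in B -> a <> 0 ->
  exists2 b, b \in B & bform a b <> 0.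
Proof.
move=> nd aB an0; apply: contrapT => H; apply/an0/nd => // b bB.
by apply: contrapT => nb; apply: H; exists b.
Qed.

Lemma nontrivial_torsion B (p k : nat) : B != 1%G -> (forall x : D, x *+ p ^ k = 0) ->
  exists z : D, [/\ z \in B, z <> 0 & z *+ p = 0].
Proof.
move=> Bn1 exp; have /trivgPn[z zB z1] : B :!=: 1%g by [].
have [|j [zj zjp]] := last_nonzero_multiple (z := z) _ (exp z).
  by move=> z0; move/eqP: z1; apply.
by exists (z *+ p ^ j); split=> //; apply: groupMn.
Qed.

(** A nontrivial nondegenerate B contains z of order p and y with b(z,y) nonzero. Then y is not p
    y', since b(z,p y') = b(p z,y') = 0; hence y generates the whole group. *)
Lemma cyclic_prime (p k : nat) (v : D) (w : int) :
  prime p -> (0 < k)%N -> v *+ p ^ k = 0 -> (forall x : D, exists n : nat, x = v *+ n) ->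
  bform v v = fr R (p ^ k) w -> ~~ (p %| w)%Z -> is_prime_anyon_theory D.
Proof.
move=> pp k0 vN gen bv pw; have N0 : (0 < p ^ k)%N by rewrite expn_gt0 prime_gt0.
have exp (x : D) : x *+ p ^ k = 0 by have [n ->] := gen x; rewrite mulrnAC vN mul0rn.
split.
- split=> // a _ /(_ v (in_setT _)); have [n ->] := gen a.
  rewrite -[v *+ n]/(v *~ n%:Z) (bformMzl thD) bv frMz => /eqP.
  rewrite fr_eq0 // Gauss_dvdzr; last exact: coprimez_pX.
  by move=> /dvdzP[m ->]; rewrite mulrC mulrzA -[_ *~ (p ^ k)%N]/(v *+ p ^ k) vN mul0rz.
- exists v; apply/eqP => v0; move/negP: pw; apply.
  have := bv; rewrite {1}v0 (bform0l thD) => /esym/eqP; rewrite fr_eq0 //.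
  by apply: dvdz_trans; rewrite dvdzE /= dvdn_exp.
- move=> B Bn1 Bprop nd; have [z [zB z0 zp]] := nontrivial_torsion Bn1 exp.
  have [y yB] := nondegenerate_witness nd zB z0; apply; have [n yn] := gen y.
  have [/dvdnP[m nm]|pn] := boolP (p %| n)%N.
    rewrite yn nm mulrnA -[_ *+ p]/(_ *~ p%:Z) (bformMzr thD) -(bformMzl thD).
    by rewrite -[z *~ p%:Z]/(z *+ p) zp (bform0l thD).
  have [b /dvdzP[q Eq]] : exists b, ((p ^ k)%N %| n%:Z * b - 1)%Z.
    by apply: inv_modz; apply: coprimez_pX.
  suff vB : v \in B.
    move: Bprop; rewrite properE => /andP[_ /subsetPn[x _]].
    by have [i ->] := gen x; rewrite groupMn.
  rewrite (_ : v = y *~ b); first exact: groupMz.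
  rewrite yn -[v *+ n]/(v *~ n%:Z) -mulrzA (_ : n%:Z * b = 1 + (p ^ k)%N%:Z * q).
    by rewrite mulrzDr mulrzA -[v *~ (p ^ k)%N]/(v *+ p ^ k) vN mul0rz addr0.
  by apply: (eqr_comb Eq); ring.
Qed.

(** A nontrivial nondegenerate B contains z of order 2, and z = 2^(k-1) z'. If a in B pairs
    nontrivially with z, then 2^(k-1) a is nonzero, so it pairs nontrivially with some b in B, and
    b(a,b) has odd numerator over 2^k. The combinations of a and b already exhaust the group. *)
Lemma frame_prime (k : nat) (al be ga : int) (x y : D) :
  (0 < k)%N -> frame k al be ga x y -> ~~ (2 %| ga)%Z ->
  (forall z : D, exists s t : nat, z = x *+ s + y *+ t) -> (#|D| <= #|Z2k2 k|)%N ->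
  is_prime_anyon_theory D.
Proof.
move=> k0 fxy oga gen card; have N0 : (0 < 2 ^ k)%N by rewrite expn_gt0.
have [xN yN _ _ bxy] := fxy.
have exp (z : D) : z *+ 2 ^ k = 0.
  by have [s [t ->]] := gen z; rewrite mulrnDl !(mulrnAC _ _ (2 ^ k)) xN yN !mul0rn addr0.
have Mz (z : D) (s : nat) : ((2 ^ k)%N%:Z %| s%:Z)%Z -> z *+ s = 0.
  by rewrite dvdzE /= => /dvdnP[m ->]; rewrite mulnC mulrnA exp mul0rn.
split.
- split=> // a _ Ha; have [s [t aE]] := gen a.
  have Hx := Ha x (in_setT _); have Hy := Ha y (in_setT _); rewrite aE in Hx Hy *.
  have [/Mz -> /Mz ->] := frame_indep thD (s := s) (t := t) fxy oga Hx Hy.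
  by rewrite addr0.
- exists x; apply/eqP => x0; move/negP: oga; apply.
  have := bxy; rewrite {1}x0 (bform0l thD) => /esym/eqP; rewrite fr_eq0 //.
  by apply: dvdz_trans; rewrite dvdzE /= dvdn_exp.
- move=> B Bn1 Bprop nd; have [z [zB z0 z2]] := nontrivial_torsion Bn1 exp.
  have [z' zz'] : exists z', z = z' *+ 2 ^ k.-1.
    have [s [t zE]] := gen z.
    have z2E : x *~ (s * 2)%N + y *~ (t * 2)%N = 0.
      by rewrite -z2 zE mulrnDl -!mulrnA.
    have half (m : nat) : ((2 ^ k)%N%:Z %| (m * 2)%N%:Z)%Z -> (2 ^ k.-1 %| m)%N.
      by rewrite dvdzE /= -{1}(prednK k0) expnSr dvdn_pmul2r.
    have := frame_indep thD fxy oga (s := (s * 2)%N) (t := (t * 2)%N).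
    rewrite z2E !(bform0l thD) => /(_ erefl erefl)[/half/dvdnP[s' sE] /half/dvdnP[t' tE]].
    by exists (x *+ s' + y *+ t'); rewrite zE sE tE mulrnDl -!mulrnA.
  have bMn (a b : D) n : bform (a *+ n) b = bform a b *+ n by apply: (bformMzl thD _ _ n).
  have [a aB za] := nondegenerate_witness nd zB z0.
  have a0 : a *+ 2 ^ k.-1 <> 0.
    move=> a0; apply: za; rewrite zz' bMn (bformC thD) -bMn a0 (bform0l thD) //.
  have [b bB ab] := nondegenerate_witness nd (groupMn _ aB) a0.
  have [||ga' [abE oga']] := @fr_primitive R 2 k (bform a b) isT k0 _ _.
  + by rewrite -bMn exp (bform0l thD).
  + by rewrite -bMn.
  have q_fr (c : D) : exists al, qform c = fr R (2 ^ k) al.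
    have [s [t ->]] := gen c.
    by have := qform_frame thD s t fxy; eexists; eassumption.
  have [al' qa] := q_fr a; have [be' qb] := q_fr b.
  have fab : frame k al' be' ga' a b by split.
  have g_bij : bijective (frame_map (k := k) a b).
    by apply: inj_card_bij => //; apply: (frame_map_inj thD k0 fab oga').
  move: Bprop; rewrite properE => /andP[_ /subsetPn[c _]].
  have [h _ hK] := g_bij; rewrite -(hK c) /frame_map.
  by rewrite groupDz // groupMn.
Qed.

End Models.

(** * Square classes *)

Section PrimeField.
Variables (p : nat) (p_pr : prime p).

Lemma Fp_nat_eq (m n : nat) : (m%:R == n%:R :> 'F_p) = (m == n %[mod p])%N.
Proof. by rewrite -val_eqE /= !val_Fp_nat. Qed.

Lemma Fp_nat_eq0 (n : nat) : (n%:R == 0 :> 'F_p) = (p %| n)%N.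
Proof. by rewrite (Fp_nat_eq n 0) mod0n. Qed.

Lemma Fp_int_eq0 (m : int) : (m%:~R == 0 :> 'F_p) = (p%:Z %| m)%Z.
Proof.
case: m => n; first exact: Fp_nat_eq0.
by rewrite NegzE rmorphN oppr_eq0 dvdzE abszN /= -Fp_nat_eq0.
Qed.

Lemma legendre_eq1 (a : nat) : coprime p a ->
  (legendre p a = 1) <-> (exists s : 'F_p, s ^+ 2 = a%:R).
Proof.
rewrite prime_coprime // /legendre => /negPf->; case: existsP => [[x /eqP E]|N].
  split=> // _; exists (x : nat)%:R; rewrite -natrX; apply/eqP.
  by rewrite Fp_nat_eq; apply/eqP.
split=> // -[s E]; case: N; have sp : (s < p)%N by rewrite -[X in (_ < X)%N](Fp_cast p_pr).
by exists (Ordinal sp) => /=; rewrite -Fp_nat_eq natrX natr_Zp E.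
Qed.

Lemma legendre_pm (a : nat) : coprime p a -> legendre p a = 1 \/ legendre p a = -1.
Proof.
by rewrite prime_coprime // /legendre => /negPf->; case: ifP => _; [left|right].
Qed.

(* The unit group of a finite field is cyclic, so squares have index at most two. *)
Lemma Fp_square_class (x y : 'F_p) : x != 0 -> y != 0 ->
  ((exists s, s ^+ 2 = x) <-> (exists s, s ^+ 2 = y)) -> exists a, a ^+ 2 * x = y.
Proof.
move=> x0 y0 sq.
have [g gE] : exists g : 'F_p, forall z, z != 0 -> exists n, z = g ^+ n.
  have /cyclicP[u uE] := field_unit_group_cyclic [set: {unit 'F_p}].
  exists (FinRing.uval u) => z z0; have zU : z \is a GRing.unit by rewrite unitfE.
  have /cycleP[n E] : FinRing.unit 'F_p zU \in <[u]>%g by rewrite -uE inE.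
  by exists n; rewrite -FinRing.val_unitX -E.
have [n xE] := gE x x0; have [m yE] := gE y y0.
have even_sq i : ~~ odd i -> exists s : 'F_p, s ^+ 2 = g ^+ i.
  by move=> ei; exists (g ^+ i./2); rewrite -exprM muln2 even_halfK.
have [t tE] : exists t, t ^+ 2 = x * y.
  case: (boolP (odd n)) => on; case: (boolP (odd m)) => om.
  - by rewrite xE yE -exprD; apply: even_sq; rewrite oddD on om.
  - have [] : exists s, s ^+ 2 = x by apply/sq; rewrite yE; apply: even_sq.
    have [] : exists s, s ^+ 2 = y by rewrite yE; apply: even_sq.
    by move=> s <- r <-; exists (r * s); rewrite exprMn.
  - have [] : exists s, s ^+ 2 = y by apply/sq; rewrite xE; apply: even_sq.
    have [] : exists s, s ^+ 2 = x by rewrite xE; apply: even_sq.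
    by move=> s <- r <-; exists (s * r); rewrite exprMn.
  - by rewrite xE yE -exprD; apply: even_sq; rewrite oddD (negPf on) (negPf om).
by exists (t / x); rewrite expr_div_n tE expr2; field.
Qed.

Hypothesis p_odd : p <> 2%N.

Let coprime2 : coprime p 2. Proof. exact: coprime_odd_prime. Qed.

Lemma legendre_square_class (u u' : nat) : coprime p u -> coprime p u' ->
  legendre p (2 * u) = legendre p (2 * u') -> exists a : int, (p%:Z %| a * a * u%:Z - u'%:Z)%Z.
Proof.
move=> cu cu' E.
have c2 v : coprime p v -> coprime p (2 * v) by move=> cv; rewrite coprimeMr coprime2.
have n0 v : coprime p v -> (2 * v)%N%:R != 0 :> 'F_p.
  by move=> /c2; rewrite prime_coprime // Fp_nat_eq0.
have [|a aE] := Fp_square_class (n0 u cu) (n0 u' cu').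
  have L := legendre_eq1 (c2 u cu); have L' := legendre_eq1 (c2 u' cu'); rewrite E in L.
  by split=> [/L/L'|/L'/L].
have two0 : 2 != 0 :> 'F_p by rewrite (Fp_nat_eq0 2) -prime_coprime.
exists (a : nat)%:Z; rewrite -Fp_int_eq0 rmorphB !rmorphM /=.
rewrite -[a%:Z%:~R]/((a : nat)%:R) natr_Zp subr_eq0; apply/eqP/(mulfI two0).
by rewrite mulrCA -[2 * u%:Z%:~R](natrM _ 2 u) -[RHS](natrM _ 2 u') -aE expr2.
Qed.

Lemma legendre_square_mul (u u' : nat) (a : int) : coprime p u -> coprime p u' ->
  (p%:Z %| a * a * u%:Z - u'%:Z)%Z -> legendre p (2 * u) = legendre p (2 * u').
Proof.
move=> cu cu' /[dup] pd; rewrite -Fp_int_eq0 rmorphB !rmorphM /= subr_eq0 => /eqP E.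
have c2 v : coprime p v -> coprime p (2 * v) by move=> cv; rewrite coprimeMr coprime2.
have u'0 : u'%:R != 0 :> 'F_p by rewrite Fp_nat_eq0 -prime_coprime.
set b : 'F_p := a%:~R in E.
have b0 : b != 0 by apply: contra_neq u'0 => b0; rewrite -[u'%:R]/(u'%:Z%:~R) -E b0 !mul0r.
have iff : (exists s : 'F_p, s ^+ 2 = (2 * u)%N%:R) <-> (exists s : 'F_p, s ^+ 2 = (2 * u')%N%:R).
  have E' : (2 * u')%N%:R = b ^+ 2 * (2 * u)%N%:R :> 'F_p.
    by rewrite !natrM mulrCA expr2 E.
  split=> -[s sE]; first by exists (b * s); rewrite exprMn sE E'.
  by exists (s / b); rewrite expr_div_n sE E'; field.
have L := legendre_eq1 (c2 u cu); have L' := legendre_eq1 (c2 u' cu').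
case: (legendre_pm (c2 u cu)) => H; first by rewrite H; symmetry; apply/L'/iff/L.
case: (legendre_pm (c2 u' cu')) => H'; last by rewrite H H'.
by rewrite H'; apply/L/iff/L'.
Qed.

(** For eps = 1, u = 2 makes 2u the square 4. For eps = -1, squaring identifies 1 and -1, so on the
    finite field it misses some y, and (p + 1)/2 is the inverse of 2. *)
Lemma exists_legendre (eps : int) : eps = 1 \/ eps = -1 ->
  exists u : nat, [/\ (0 < u)%N, coprime p u & legendre p (2 * u) = eps].
Proof.
have p2 : (2 < p)%N by rewrite ltn_neqAle prime_gt1 // andbT eq_sym; apply/eqP.
case=> ->.
  exists 2; split=> //; apply/legendre_eq1; first by rewrite coprimeMr coprime2.
  by exists 2; rewrite -natrX.
have [y yN] : exists y : 'F_p, forall x, x ^+ 2 != y.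
  apply: contrapT => H; have sur : forall y : 'F_p, exists x : 'F_p, x ^+ 2 = y.
    move=> y; apply: contrapT => N; apply: H; exists y => x.
    by apply/eqP => E; apply: N; exists x.
  have [h hK] := choice sur.
  have K : cancel (fun x : 'F_p => x ^+ 2) h by apply: canF_sym hK.
  have : (1 : 'F_p) = -1 by apply: (can_inj K); rewrite sqrrN.
  move=> /eqP; rewrite -subr_eq0 opprK (Fp_nat_eq0 2) -[(_ %| _)%N]negbK.
  by rewrite -prime_coprime // coprime2.
have y0 : y != 0 by apply: contra_neq (yN 0) => ->; rewrite expr0n.
pose u := (y * p.+1./2)%N.
have uE : (2 * u)%N%:R = y.
  have -> : (2 * u = y * p.+1)%N.
    have op : odd p by rewrite -coprime2n coprime_sym coprime2.
    by rewrite /u mulnCA mul2n even_halfK //= op.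
  by rewrite natrM natr_Zp -addn1 natrD pchar_Fp_0 // add0r mulr1.
have c2u : coprime p (2 * u) by rewrite prime_coprime // -Fp_nat_eq0 uE.
have cu : coprime p u by move: c2u; rewrite coprimeMr coprime2.
exists u; split=> //.
  by rewrite lt0n; apply: contraTneq cu => ->; rewrite /coprime gcdn0; move: p2; case: (p) => [|[|[]]].
case: (legendre_pm c2u) => // /(legendre_eq1 c2u)[s sE].
by have := yN s; rewrite sE uE eqxx.
Qed.

(** Newton's iteration: the derivative 2 b u is a unit modulo p, since p is odd and a common factor
    of p with b or u would divide u'. *)
Lemma hensel_square (k : nat) (u u' a : int) : ~~ (p%:Z %| u')%Z ->
  (p%:Z %| a * a * u - u')%Z -> exists b, ((p ^ k)%N%:Z %| b * b * u - u')%Z.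
Proof.
move=> pu' pa; suff [b] : exists b, ((p ^ k.+1)%N%:Z %| b * b * u - u')%Z.
  by move=> Pb; exists b; apply: dvdz_trans Pb; rewrite dvdzE /= dvdn_exp2l.
elim: k => [|k [b /dvdzP[m Em]]]; first by exists a; rewrite expn1.
set q := (p ^ k.+1)%N%:Z in Em.
have /dvdzP[r qE] : (p%:Z %| q)%Z by rewrite dvdzE /= dvdn_exp.
have [i /dvdzP[n En]] : exists i, ((p ^ 1)%N%:Z %| (2 * b * u) * i - 1)%Z.
  apply: inv_modz; apply: coprimez_pX => //.
  apply: contra pu'; rewrite dvdzE !abszM /= !Euclid_dvdM // -!orbA => /or3P[].
  - by rewrite (_ : (p %| 2)%N = false) //; apply/negP/negP; rewrite -prime_coprime.
  - move=> pd; have /dvdzP[c bE] : (p%:Z %| b)%Z by rewrite dvdzE.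
    rewrite (_ : u' = b * b * u - m * q).
      by rewrite bE qE; apply/dvdzP; exists (c * c * p%:Z * u - m * r); ring.
    by apply: (eqr_comb (eqrN2 Em)); ring.
  - move=> pd; have /dvdzP[c uE] : (p%:Z %| u)%Z by rewrite dvdzE.
    rewrite (_ : u' = b * b * u - m * q).
      by rewrite uE qE; apply/dvdzP; exists (b * b * c - m * r); ring.
    by apply: (eqr_comb (eqrN2 Em)); ring.
rewrite expn1 in En; exists (b - m * i * q).
have -> : (p ^ k.+2)%N%:Z = p%:Z * q by rewrite expnS PoszM.
apply/dvdzP; exists (- (m * n) + m * m * i * i * u * r).
apply: (eqr_comb (eqrD2 (eqrD2 Em (eqrN2 (congr1 ( *%R (m * q)) En)))
  (congr1 ( *%R (m * m * i * i * u * q)) qE))).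
ring.
Qed.

End PrimeField.

(** For a = 1 + 2s and u - u' = 8w the equation becomes 4 (u (s^2 + s) + 2w) = 0. Modulo 8 is what
    makes the constant term even, as [hensel2] requires. *)
Lemma two_adic_square (k : nat) (u u' : int) : ~~ (2 %| u)%Z -> (8 %| u - u')%Z ->
  exists a, ((2 ^ k)%N %| a * a * u - u')%Z.
Proof.
move=> ou /dvdzP[w Ew].
have [d /dvdzP[e Ee]] : exists d, ((2 ^ k)%N %| u * d - 1)%Z.
  by apply: inv_modz; apply: coprimez_pX.
have [s /dvdzP[f Ef]] : exists s, ((2 ^ k)%N %| 1 * s * s + s + d * (2 * w))%Z.
  by apply: hensel2; apply: dvdz_mull; apply: dvdz_mulr.
exists (1 + 2 * s); apply/dvdzP; exists (4 * (u * f - 2 * w * e)).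
apply: (eqr_comb (eqrD2 Ew (eqrD2 (congr1 ( *%R (4 * u)) Ef)
  (eqrN2 (congr1 ( *%R (8 * w)) Ee))))).
ring.
Qed.

(** * The models: generators, exponents, existence and primality *)

Section Listed.
Variable R : realType.

Lemma Zp_gen (N : nat) (x : 'Z_N) : exists n : nat, x = (1 : 'Z_N) *+ n.
Proof. by exists x; rewrite natr_Zp. Qed.

Lemma Zp_exponent (N : nat) (x : 'Z_N) : (1 < N)%N -> x *+ N = 0.
Proof. by move=> N1; rewrite -mulr_natr pchar_Zp // mulr0. Qed.

Lemma Z2k2_gen (k : nat) (z : Z2k2 k) : exists s t : nat, z = e1 k *+ s + e2 k *+ t.
Proof. by exists z.1, z.2; apply: Z2k2_decomp. Qed.

Lemma Z2k2_exponent (k : nat) (z : Z2k2 k) : (0 < k)%N -> z *+ 2 ^ k = 0.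
Proof.
move=> k0; rewrite [LHS]surjective_pairing (raddfMn fst) (raddfMn snd) /=.
by rewrite !Zp_exponent ?pow2_gt1.
Qed.

Lemma card_Z2k2 (k : nat) : (0 < k)%N -> #|Z2k2 k| = (2 ^ k.*2)%N.
Proof.
move=> k0; rewrite card_prod !card_ord Zp_cast ?pow2_gt1 //.
by rewrite -expnD addnn.
Qed.

Lemma fr_pow2 (k : nat) : modZ (2 ^- k) = fr R (2 ^ k) 1.
Proof. by rewrite /fr natrX div1r. Qed.

Lemma odd_datum_prime (p k u : nat) : prime p -> p <> 2%N -> (0 < k)%N -> coprime p u ->
  is_prime_anyon_theory (odd_datum R p k u).
Proof.
move=> pp p2 k0 cu; have N1 := prime_exp_gt1 pp k0.
have th := @odd_datum_theory R p k u N1.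
apply: (@cyclic_prime R (odd_datum R p k u) th p k (1 : 'Z_(p ^ k)) (u%:Z * 2)) => //.
- exact: Zp_exponent.
- exact: Zp_gen.
- by rewrite (bformxx th) [qform _]qform_odd_datum frMn.
- rewrite dvdzE abszM /= Euclid_dvdM // negb_or -!prime_coprime // cu.
  exact: coprime_odd_prime.
Qed.

Lemma qform_two_datum (k u : nat) :
  @qform R (two_datum R k u) (1 : 'Z_(2 ^ k)) = fr R (2 ^ k.+1) u.
Proof. by rewrite /qform /= !muln1. Qed.

Lemma bform_of_qform (D : abelian_datum R) (k : nat) (v : D) (u : int) :
  is_abelian_theory D -> qform v = fr R (2 ^ k.+1) u -> bform v v = fr R (2 ^ k) u.
Proof. by move=> th qv; rewrite (bformxx th) qv frMn mulrC expnS fr_mul. Qed.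

Lemma two_datum_prime (k u : nat) : (0 < k)%N -> odd u ->
  is_prime_anyon_theory (two_datum R k u).
Proof.
move=> k0 ou; have N1 := pow2_gt1 k0; have th := @two_datum_theory R k u k0 ou.
apply: (@cyclic_prime R (two_datum R k u) th 2 k (1 : 'Z_(2 ^ k)) u%:Z) => //.
- exact: Zp_exponent.
- exact: Zp_gen.
- exact: (bform_of_qform th (qform_two_datum k u)).
- by rewrite dvdzE /= dvdn2 negbK.
Qed.

Section Bilinear.
Variables (k : nat) (c : Z2k2 k -> Z2k2 k -> RmodZ R) (al be ga : int).
Hypotheses (k0 : (0 < k)%N) (bc : biadditive c).
Hypotheses (c11 : c (e1 k) (e1 k) = fr R (2 ^ k) al) (c22 : c (e2 k) (e2 k) = fr R (2 ^ k) be).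
Hypotheses (c12 : c (e1 k) (e2 k) = fr R (2 ^ k) ga) (c21 : c (e2 k) (e1 k) = 0).
Hypothesis odd_ga : ~~ (2 %| ga)%Z.

Let D := AbelianDatum (fun _ _ _ => 0) c.

Lemma bilinear_frame : @frame R D k al be ga (e1 k) (e2 k).
Proof.
split=> //; try exact: Z2k2_exponent.
by rewrite (bformE (biadditive_theory bc)) /polar /= c12 c21 addr0.
Qed.

Lemma bilinear_prime : is_prime_anyon_theory D.
Proof.
apply: (frame_prime (biadditive_theory bc) k0 bilinear_frame odd_ga) => //.
exact: Z2k2_gen.
Qed.

End Bilinear.

Lemma bilinear_exists (k : nat) (al be ga : int) : (0 < k)%N ->
  exists c : Z2k2 k -> Z2k2 k -> RmodZ R,
    [/\ biadditive c, c (e1 k) (e1 k) = fr R (2 ^ k) al, c (e2 k) (e2 k) = fr R (2 ^ k) be,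
        c (e1 k) (e2 k) = fr R (2 ^ k) ga & c (e2 k) (e1 k) = 0].
Proof.
move=> k0; have N1 := pow2_gt1 k0; have N0 := ltnW N1.
pose m (a : int) (x y : 'Z_(2 ^ k)) : RmodZ R := fr R (2 ^ k) a *+ x *+ y.
have aN a : fr R (2 ^ k) a *+ 2 ^ k = 0.
  by apply/eqP; rewrite frMn fr_eq0 // dvdz_mull.
have mDl a x y z : m a (x + y) z = m a x z + m a y z.
  by rewrite /m (mulrn_Zp N1 (aN a)) mulrnDl.
have mDr a x y z : m a x (y + z) = m a x y + m a x z.
  by rewrite /m mulrn_Zp // mulrnAC aN mul0rn.
exists (fun x y => m al x.1 y.1 + m be x.2 y.2 + m ga x.1 y.2).
split; first split=> x y z /=.
- by rewrite [m al _ _]mDl [m be _ _]mDl [m ga _ _]mDl; zmod.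
- by rewrite [m al _ _]mDr [m be _ _]mDr [m ga _ _]mDr; zmod.
- by rewrite /m /= !mulr0n !addr0.
- by rewrite /m /= !mulr0n mul0rn add0r addr0.
- by rewrite /m /= !mulr0n mul0rn !add0r.
- by rewrite /m /= !mulr0n mul0rn !addr0.
Qed.

Lemma unit_mod8 (u : nat) (eps : 'Z_8) : u%:R = eps ->
  eps = 1 \/ eps = -1 \/ eps = 5 \/ eps = -5 -> odd u.
Proof.
move=> <- H; have : odd (u %% 8).
  have := @val_Zp_nat 8 isT u; case: H => [|[|[|]]] ->  /= <- //.
by rewrite {2}(divn_eq u 8) oddD oddM andbF.
Qed.

Lemma listed_two_odd (k u : nat) (eps : 'Z_8) : listed (OmegaTwo k eps) -> u%:R = eps ->
  (0 < k)%N /\ odd u.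
Proof.
move=> L E; split; first by case: L => [[]|[/ltnW]].
by apply: (unit_mod8 E); move: L => /=; tauto.
Qed.

End Listed.

(** * Classification *)

Lemma coprime_torsion (A : zmodType) (m n : nat) (x : A) :
  coprime m n -> x *+ m = 0 -> x *+ n = 0 -> x = 0.
Proof.
move=> cop xm xn; have [|b /dvdzP[q E]] := @inv_modz m n; first by rewrite coprimezE.
rewrite -(mulr1z x) (_ : 1 = n%:Z * b - m%:Z * q); last by apply: (eqr_comb (eqrN2 E)); ring.
by rewrite mulrzBr !mulrzA -[x *~ n%:Z]/(x *+ n) -[x *~ m%:Z]/(x *+ m) xm xn !mul0rz subr0.
Qed.

Lemma exists_prime_torsion (A : zmodType) (n : nat) (x : A) :
  (0 < n)%N -> x <> 0 -> x *+ n = 0 -> exists p (z : A), [/\ prime p, z <> 0 & z *+ p = 0].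
Proof.
elim/ltn_ind: n => n IH n0 xn0 xn; have [n1|n1] := leqP n 1.
  by case: xn0; rewrite -xn (_ : n = 1%N) //; apply/eqP; rewrite eqn_leq n1 n0.
have [xm|xm] := x *+ (n %/ pdiv n) =P 0.
  apply: (IH (n %/ pdiv n)%N) => //.
  - by rewrite ltn_Pdiv // prime_gt1 // pdiv_prime.
  - by rewrite divn_gt0 ?pdiv_gt0 // dvdn_leq // pdiv_dvd.
exists (pdiv n), (x *+ (n %/ pdiv n)); split=> //; first exact: pdiv_prime.
by rewrite -mulrnA divnK ?pdiv_dvd.
Qed.

Section Classification.
Variables (R : realType) (D : abelian_datum R).
Hypothesis primeD : is_prime_anyon_theory D.

Let thD : is_abelian_theory D. Proof. by case: primeD => [[]]. Qed.

Lemma bformMnl (x y : D) n : bform (x *+ n) y = bform x y *+ n.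
Proof. exact: (bformMzl thD _ _ n). Qed.

Lemma bformMnr (x y : D) n : bform x (y *+ n) = bform x y *+ n.
Proof. exact: (bformMzr thD _ _ n). Qed.

(* [x] has maximal order among the elements of [p]-power order, so the [p]-part of
   any element pairing faithfully with [x] has order dividing that of [x]. *)
Lemma primitive_pair : exists p k (x y : D) ga, [/\ prime p, (0 < k)%N,
  x *+ p ^ k = 0, y *+ p ^ k = 0 & bform x y = fr R (p ^ k) ga /\ ~~ (p %| ga)%Z].
Proof.
have [[_ nd] [a /eqP a0] _] := primeD.
pose n := #|D|; have nK (x : D) : x *+ n = 0.
  rewrite -FinRing.zmodXgE -FinRing.zmod1gE; have := expg_cardG (in_setT x).
  by rewrite cardsT.
have n0 : (0 < n)%N by apply/card_gt0P; exists a.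
have [p [z [pp z0 zp]]] := exists_prime_torsion n0 a0 (nK a).
have [m pm nE] := pfactor_coprime pp n0; set e := logn p n in nE.
have ze : z *+ p ^ e = 0.
  have [e0|e0] := posnP e; last by rewrite -(prednK e0) expnS mulrnA zp mul0rn.
  case: z0; apply: (coprime_torsion pm zp).
  by have := nK z; rewrite {1}nE e0 expn0 muln1.
pose Q j := [forall x : D, (x *+ p ^ e == 0) ==> (x *+ p ^ j == 0)].
have exQ : exists j, Q j by exists e; apply/forallP => x; apply/implyP.
case: (ex_minnP exQ) => k /forallP Qk kmin.
have expk (x : D) : x *+ p ^ e = 0 -> x *+ p ^ k = 0.
  by move=> xe; have /implyP := Qk x; rewrite xe eqxx => /(_ isT)/eqP.
have k0 : (0 < k)%N.
  by rewrite lt0n; apply/eqP => kz; case: z0; have := expk z ze; rewrite kz expn0.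
have : ~~ Q k.-1.
  by apply/negP => /kmin; rewrite leqNgt prednK // leqnn.
case/forallPn => x; rewrite negb_imply => /andP[/eqP xe /eqP xk].
have [y0 xy0] : exists y0, bform (x *+ p ^ k.-1) y0 <> 0.
  apply: contrapT => H; apply: xk; apply: nd; rewrite ?inE // => b _.
  by apply: contrapT => nb; apply: H; exists b.
have xK := expk x xe; have yK : y0 *+ m *+ p ^ k = 0.
  by apply: expk; rewrite -mulrnA -nE nK.
exists p, k, x, (y0 *+ m).
have [||ga [bE pga]] := @fr_primitive R p k (bform x (y0 *+ m)) pp k0.
- by rewrite -bformMnl xK (bform0l thD).
- move=> b0; apply: xy0; apply: (coprime_torsion pm).
  + by rewrite -bformMnl -mulrnA -expnSr prednK // xK (bform0l thD).
  + by rewrite -bformMnr bformMnl.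
by exists ga.
Qed.

Lemma bform_torsion N (v w : D) : (0 < N)%N -> v *+ N = 0 -> exists a, bform v w = fr R N a.
Proof. by move=> N0 vN; apply: fr_surj => //; rewrite -bformMnl vN (bform0l thD). Qed.

Lemma qform_torsion N (v : D) : v *+ N = 0 -> qform v *+ N *+ N = 0.
Proof.
by move=> vN; rewrite -mulrnA; have := qformMz thD v N; rewrite -[v *~ N]/(v *+ N) vN (qform0 thD).
Qed.

Lemma odd_generator (p k : nat) (x y : D) (ga : int) : prime p -> p <> 2%N -> (0 < k)%N ->
  x *+ p ^ k = 0 -> y *+ p ^ k = 0 -> bform x y = fr R (p ^ k) ga -> ~~ (p %| ga)%Z ->
  exists (v : D) (u : nat), [/\ v *+ p ^ k = 0, (0 < u)%N, coprime p u
                              & qform v = fr R (p ^ k) u].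
Proof.
move=> pp p2 k0 xK yK bxy pga; have N0 : (0 < p ^ k)%N by rewrite expn_gt0 prime_gt0.
have cp2 := coprime_odd_prime pp p2.
have [v [w [vK bv pw]]] : exists (v : D) w,
    [/\ v *+ p ^ k = 0, bform v v = fr R (p ^ k) w & ~~ (p %| w)%Z].
  have [a bx] := bform_torsion x N0 xK; have [b by_] := bform_torsion y N0 yK.
  have [pa|pa] := boolP (p %| a)%Z; last by exists x, a.
  have [pb|pb] := boolP (p %| b)%Z; last by exists y, b.
  (* Here p divides a and b but not 2 ga, as p is odd. *)
  exists (x + y), (a + b + ga * 2); split.
  - by rewrite mulrnDl xK yK addr0.
  - rewrite !(bformDl thD) !(bformDr thD) (bformC thD y x) bx by_ bxy !frD -frMn mulr2n.
    by zmod.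
  - rewrite rpredDl; last exact: rpredD.
    by rewrite Gauss_dvdzl // coprimezE.
(* p^k q(v) is killed by p^k, because q(p^k v) = 0, and by 2, because 2 q(v) = b(v,v). *)
have qvK : qform v *+ p ^ k = 0.
  apply: (coprime_torsion (coprimeXl k cp2)); first exact: qform_torsion.
  by rewrite mulrnAC -(bformxx thD) -bformMnl vK (bform0l thD).
have [u0 qu0] := fr_surj N0 qvK; have [u [u0' uE]] := fr_pos R u0 N0.
exists v, u; rewrite qu0 uE; split=> //; rewrite prime_coprime //.
apply: contra pw => pu; have := bformxx thD v; rewrite bv qu0 uE frMn => /eqP.
rewrite fr_eq // => H; rewrite -(subrK (u%:Z * 2) w); apply: rpredD.
  by apply: dvdz_trans H; rewrite dvdzE /= dvdn_exp.
by apply: dvdz_mulr; rewrite dvdzE.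
Qed.

Lemma two_generator (k : nat) (x y : D) (ga : int) : (0 < k)%N ->
  x *+ 2 ^ k = 0 -> y *+ 2 ^ k = 0 -> bform x y = fr R (2 ^ k) ga -> ~~ (2 %| ga)%Z ->
  (exists (v : D) (u : nat), [/\ v *+ 2 ^ k = 0, odd u & qform v = fr R (2 ^ k.+1) u]) \/
  has_frame D k 0 0 1 \/ has_frame D k 1 1 (-1).
Proof.
move=> k0 xK yK bxy oga; have N0 : (0 < 2 ^ k)%N by rewrite expn_gt0.
have NN0 : (0 < 2 ^ k.+1)%N by rewrite expn_gt0.
have dich (v : D) : v *+ 2 ^ k = 0 ->
    (exists u : nat, odd u /\ qform v = fr R (2 ^ k.+1) u) \/
    exists al, qform v = fr R (2 ^ k) al.
  move=> vK; have q2 : qform v *+ 2 ^ k.+1 = 0.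
    by rewrite expnS mulrnA -(bformxx thD) -bformMnl vK (bform0l thD).
  have [u0 qu0] := fr_surj NN0 q2; have [u [_ uE]] := fr_pos R u0 NN0.
  rewrite qu0 uE; case: (boolP (odd u)) => [ou|eu]; first by left; exists u.
  right; exists u./2%:Z; rewrite -(@fr_mul R (2 ^ k) 2 u./2%:Z) // -expnS -PoszM.
  by rewrite mul2n even_halfK.
case: (dich x xK) => [[u [ou qx]]|[al qx]]; first by left; exists x, u.
case: (dich y yK) => [[u [ou qy]]|[be qy]]; first by left; exists y, u.
right; apply: (frame_normal thD k0 (al := al) (be := be) _ oga).
by exists x, y; split.
Qed.

Lemma odd_equivalent (p k u : nat) (v : D) : prime p -> p <> 2%N -> (0 < k)%N ->
  coprime p u -> v *+ p ^ k = 0 -> qform v = fr R (p ^ k) u ->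
  equivalent D (odd_datum R p k u).
Proof.
move=> pp p2 k0 cu vK qv; have N1 := prime_exp_gt1 pp k0.
apply: (cyclic_equivalent primeD N1 vK (w := u%:Z * 2)).
- by rewrite (bformxx thD) qv frMn.
- apply: coprimez_pX => //; rewrite dvdzE abszM /= Euclid_dvdM // negb_or -!prime_coprime // cu.
  exact: coprime_odd_prime.
- exact: odd_datum_theory.
- by rewrite qv -qform_odd_datum.
Qed.

Lemma two_equivalent (k u : nat) (v : D) : (0 < k)%N ->
  odd u -> v *+ 2 ^ k = 0 -> qform v = fr R (2 ^ k.+1) u -> equivalent D (two_datum R k u).
Proof.
move=> k0 ou vK qv; have N1 := pow2_gt1 k0.
apply: (cyclic_equivalent primeD N1 vK (bform_of_qform thD qv)).
- by apply: coprimez_pX => //; rewrite dvdzE /= dvdn2 negbK.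
- exact: two_datum_theory.
- by rewrite qv -qform_two_datum.
Qed.

End Classification.

(** What equivalence leaves on quadratic forms. Its symmetry and transitivity involve no cochains,
    and the comparison of names uses only q. *)
Definition isometric (R : realType) (D D' : abelian_datum R) : Prop :=
  exists h : D -> D', [/\ {morph h : x y / x + y}, bijective h & forall x, qform (h x) = qform x].

Lemma isometric_sym (R : realType) (D D' : abelian_datum R) :
  isometric D D' -> isometric D' D.
Proof.
move=> [h [hD [g hK gK] hq]]; exists g; split; [exact: can_morphD hK gK|by exists h|].
by move=> x; rewrite -hq gK.
Qed.

Lemma isometric_trans (R : realType) (D1 D2 D3 : abelian_datum R) :
  isometric D1 D2 -> isometric D2 D3 -> isometric D1 D3.
Proof.
move=> [h [hD hb hq]] [g [gD gb gq]]; exists (g \o h); split=> [x y||x] /=.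
- by rewrite hD gD.
- exact: bij_comp.
- by rewrite gq hq.
Qed.

Lemma equivalent_isometric (R : realType) (D D' : abelian_datum R) :
  equivalent D D' -> isometric D D'.
Proof.
by move=> /qform_of_equivalent[f [fb fq]]; exists f; split=> //; apply: raddfD.
Qed.

Lemma isometric_card (R : realType) (D D' : abelian_datum R) : isometric D D' -> #|D| = #|D'|.
Proof. by move=> [h [_ hb _]]; apply: bij_eq_card hb. Qed.

Lemma morphMn (A B : zmodType) (h : A -> B) (x : A) n :
  {morph h : x y / x + y} -> h (x *+ n) = h x *+ n.
Proof.
move=> hD; have h0 : h 0 = 0 by apply: (addrI (h 0)); rewrite -hD !addr0.
by elim: n => [|n IH]; rewrite ?mulr0n // !mulrSr hD IH.
Qed.

(** * Names, the theories they denote, and their invariants *)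

Section Names.
Variable R : realType.
Implicit Types (D : abelian_datum R) (l : theory_name).

(** The common shape of E_k, with coefficients (0, 0, 1), and of F_k, with (1, 1, -1). *)
Definition bilinear_datum (k : nat) (al be ga : int) (D : abelian_datum R) : Prop :=
  exists c : Z2k2 k -> Z2k2 k -> RmodZ R,
    [/\ biadditive c, c (e1 k) (e1 k) = fr R (2 ^ k) al /\ c (e2 k) (e2 k) = fr R (2 ^ k) be,
        c (e1 k) (e2 k) = fr R (2 ^ k) ga, c (e2 k) (e1 k) = 0
      & D = AbelianDatum (fun _ _ _ => 0) c].

Lemma denotesE (k : nat) D : denotes (TypeE k) D <-> bilinear_datum k 0 0 1 D.
Proof.
rewrite /= /bilinear_datum -fr_pow2 fr0.
split=> -[c]; first by move=> [bc [c11 c22 c21] c12 ->]; exists c.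
by move=> [bc [c11 c22] c12 c21 ->]; exists c.
Qed.

Lemma denotesF (k : nat) D : denotes (TypeF k) D <-> bilinear_datum k 1 1 (-1) D.
Proof.
rewrite /= /bilinear_datum raddfN /= frN -fr_pow2.
split=> -[c]; first by move=> [bc c11 c21 c12 ->]; exists c.
by move=> [bc c11 c12 c21 ->]; exists c.
Qed.

Lemma bilinear_datum_exists (k : nat) (al be ga : int) : (0 < k)%N ->
  exists D, bilinear_datum k al be ga D.
Proof.
move=> /(bilinear_exists R al be ga)[c [bc c11 c22 c12 c21]].
by exists (AbelianDatum (fun _ _ _ => 0) c), c.
Qed.

Lemma bilinear_datum_prime (k : nat) (al be ga : int) D : (0 < k)%N -> ~~ (2 %| ga)%Z ->
  bilinear_datum k al be ga D -> is_prime_anyon_theory D.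
Proof. by move=> k0 oga [c [bc [c11 c22] c12 c21 ->]]; exact: (bilinear_prime k0 bc c11 c22 c12 c21 oga). Qed.

Lemma frame_equivalent_bilinear (k : nat) (al be ga : int) D D' :
  is_prime_anyon_theory D -> (0 < k)%N -> ~~ (2 %| ga)%Z -> has_frame D k al be ga ->
  bilinear_datum k al be ga D' -> equivalent D D'.
Proof.
move=> pD k0 oga [x [y fxy]] [c [bc [c11 c22] c12 c21 ->]].
apply: (frame_equivalent pD k0 fxy oga); first exact: biadditive_theory.
exact: bilinear_frame.
Qed.

Lemma bilinear_datum_frame (k : nat) (al be ga : int) D : (0 < k)%N ->
  bilinear_datum k al be ga D ->
  [/\ #|D| = (2 ^ k.*2)%N, forall x : D, x *+ 2 ^ k = 0 &
      exists x y : D, frame k al be ga x y /\ forall z, exists s t : nat, z = x *+ s + y *+ t].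
Proof.
move=> k0 [c [bc [c11 c22] c12 c21 ->]]; split=> [|x|].
- exact: card_Z2k2.
- exact: Z2k2_exponent.
- exists (e1 k), (e2 k); split; first exact: bilinear_frame.
  exact: Z2k2_gen.
Qed.

Lemma denotes_exists l : listed l -> exists D, denotes l D.
Proof.
case: l => [p k eps|k eps|k|k] /=.
- move=> [pp p2 k0 /(exists_legendre pp p2)[u [u0 cu lu]]].
  by exists (odd_datum R p k u), u.
(* Adding 8 keeps the residue and makes u visibly positive. *)
- move=> _; exists (two_datum R k (eps + 8)%N), (eps + 8)%N; split=> //.
    by rewrite addn_gt0 orbT.
  by rewrite natrD natr_Zp -[8%N]/((Zp_trunc 8).+2) pchar_Zp // addr0.
- by move=> /(bilinear_datum_exists 0 0 1)[D DE]; exists D; apply/denotesE.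
- by move=> /(bilinear_datum_exists 1 1 (-1))[D DF]; exists D; apply/denotesF.
Qed.

Lemma denotes_prime l D : listed l -> denotes l D -> is_prime_anyon_theory D.
Proof.
case: l => [p k eps|k eps|k|k] L.
- by case: L => pp p2 k0 _ [u [_ cu _ ->]]; apply: odd_datum_prime.
- by move=> [u [_ /(listed_two_odd L)[k0 ou] ->]]; apply: two_datum_prime.
- by move=> /denotesE; apply: bilinear_datum_prime.
- by move=> /denotesF; apply: bilinear_datum_prime.
Qed.

(** In the cyclic cases two admissible u differ by a square a^2 modulo the denominator of q, and a
    times the generator takes the other value. *)
Lemma denotes_equivalent l D D' : listed l -> denotes l D -> denotes l D' -> equivalent D D'.
Proof.
move=> L dD; have pD := denotes_prime L dD.
case: l L dD => [p k eps|k eps|k|k] L.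
- case: L => pp p2 k0 _ [u [_ cu lu DE]] [u' [_ cu' lu' ->]]; subst D.
  have N1 := prime_exp_gt1 pp k0.
  have N0 := ltnW N1.
  have [|a0 pa0] := legendre_square_class pp p2 cu cu'; first by rewrite lu.
  have pu' : ~~ (p%:Z %| u'%:Z)%Z by rewrite dvdzE /= -prime_coprime.
  have [a pa] := hensel_square pp p2 k pu' pa0.
  apply: (odd_equivalent pD pp p2 k0 cu' (v := (1 : 'Z_(p ^ k)) *~ a)).
    exact: Zp_exponent.
  rewrite (qformMz (odd_datum_theory R u N1)) [qform _]qform_odd_datum frMz.
  by apply/eqP; rewrite fr_eq // mulrC.
- move=> [u [_ ueps DE]] [u' [_ ueps' ->]]; subst D.
  have [k0 ou] := listed_two_odd L ueps; have [_ ou'] := listed_two_odd L ueps'.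
  have N1 := pow2_gt1 k0.
  have [||a pa] := @two_adic_square k.+1 u u'.
  + by rewrite dvdzE /= dvdn2 negbK.
  + have : (u %% 8 = u' %% 8)%N.
      by rewrite -!(@val_Zp_nat 8) // ueps ueps'.
    by clear; lia.
  apply: (two_equivalent pD k0 ou' (v := (1 : 'Z_(2 ^ k)) *~ a)).
    exact: Zp_exponent.
  rewrite (qformMz (two_datum_theory R k0 ou)) qform_two_datum frMz.
  by apply/eqP; rewrite fr_eq ?expn_gt0 // mulrC.
- move=> /denotesE dD /denotesE; apply: frame_equivalent_bilinear => //.
  by have [_ _ [x [y [fxy _]]]] := bilinear_datum_frame L dD; exists x, y.
- move=> /denotesF dD /denotesF; apply: frame_equivalent_bilinear => //.
  by have [_ _ [x [y [fxy _]]]] := bilinear_datum_frame L dD; exists x, y.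
Qed.

Lemma prime_classified D : is_prime_anyon_theory D ->
  exists l, listed l /\ exists D', denotes l D' /\ equivalent D D'.
Proof.
move=> pD; have [p [k [x [y [ga [pp k0 xK yK [bxy pga]]]]]]] := primitive_pair pD.
case: (p =P 2%N) => [p2|p2]; last first.
  have [v [u [vK u0 cu qv]]] := odd_generator pD pp p2 k0 xK yK bxy pga.
  exists (OmegaOdd p k (legendre p (2 * u))); split.
    split=> //; apply: legendre_pm => //; rewrite coprimeMr cu andbT.
    exact: coprime_odd_prime.
  exists (odd_datum R p k u); split; first by exists u.
  exact: (odd_equivalent pD pp p2 k0 cu vK qv).
subst p; case: (two_generator pD k0 xK yK bxy pga) => [[v [u [vK ou qv]]]|[H|H]].
- have NN0 : (0 < 2 ^ k.+1)%N by rewrite expn_gt0.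
  have [u' [ou' qv' L]] : exists u' : nat, [/\ odd u', qform v = fr R (2 ^ k.+1) u'
      & listed (OmegaTwo k u'%:R)].
    have mod8 (n : nat) (eps : 'Z_8) : (n %% 8)%N = eps -> n%:R = eps.
      by move=> E; apply: val_inj; apply: etrans E; apply: (@val_Zp_nat 8).
    have : [|| u %% 8 == 1, u %% 8 == 3, u %% 8 == 5 | u %% 8 == 7]%N by lia.
    (* For k = 1 the denominator is 4, so the residues 3 and 5 of u can be moved to 7 and 1, which
       are listed. *)
    have qv4 : k = 1%N -> qform v = fr R (2 ^ k.+1) (u + 4)%N.
      move=> k1; rewrite qv; apply/eqP; rewrite fr_eq // k1 PoszD.
      by apply/dvdzP; exists (-1); ring.
    have k12 : k = 1%N \/ (2 <= k)%N by lia.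
    have ou4 : odd (u + 4) by rewrite oddD ou.
    case/or4P => /eqP u8.
    + by exists u; split=> //=; rewrite (mod8 u 1) //; left; split=> //; left.
    + case: k12 => k12; last first.
        by exists u; split=> //=; rewrite (mod8 u (-5)) //; right; split=> //; right.
      exists (u + 4)%N; split=> //=; first exact: qv4.
      have u84 : ((u + 4) %% 8 = 7)%N by clear -u8; lia.
      by rewrite (mod8 (u + 4)%N (-1)) //; left; split=> //; right.
    + case: k12 => k12; last first.
        by exists u; split=> //=; rewrite (mod8 u 5) //; right; split=> //; left.
      exists (u + 4)%N; split=> //=; first exact: qv4.
      have u84 : ((u + 4) %% 8 = 1)%N by clear -u8; lia.
      by rewrite (mod8 (u + 4)%N 1) //; left; split=> //; left.
    + by exists u; split=> //=; rewrite (mod8 u (-1)) //; left; split=> //; right.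
  exists (OmegaTwo k u'%:R); split=> //; exists (two_datum R k u'); split.
    by exists u'; split=> //; case: (u') ou'.
  exact: (two_equivalent pD k0 ou' vK qv').
- exists (TypeE k); split=> //; have [D' dD'] := bilinear_datum_exists 0 0 1 k0.
  by exists D'; split; [apply/denotesE|apply: frame_equivalent_bilinear dD'].
- exists (TypeF k); split=> //; have [D' dD'] := bilinear_datum_exists 1 1 (-1) k0.
  by exists D'; split; [apply/denotesF|apply: frame_equivalent_bilinear dD'].
Qed.

Lemma card_odd_datum (p k u : nat) : (1 < p ^ k)%N -> #|odd_datum R p k u| = (p ^ k)%N.
Proof. by move=> N1; rewrite card_ord Zp_cast. Qed.

Lemma card_two_datum (k u : nat) : (0 < k)%N -> #|two_datum R k u| = (2 ^ k)%N.
Proof. by move=> k0; rewrite card_ord Zp_cast // pow2_gt1. Qed.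

Lemma isometric_odd_odd (p k u u' : nat) : prime p -> p <> 2%N -> (0 < k)%N ->
  coprime p u -> coprime p u' ->
  isometric (odd_datum R p k u) (odd_datum R p k u') -> legendre p (2 * u) = legendre p (2 * u').
Proof.
move=> pp p2 k0 cu cu' [h [_ _ hq]].
have N1 := prime_exp_gt1 pp k0.
have [n nE] := Zp_gen (h (1 : 'Z_(p ^ k))).
have := hq (1 : 'Z_(p ^ k)); rewrite nE [RHS]qform_odd_datum.
rewrite -[_ *+ n]/((1 : 'Z_(p ^ k)) *~ n%:Z) (qformMz (odd_datum_theory R u' N1)).
rewrite [qform _]qform_odd_datum frMz => /eqP; rewrite fr_eq ?(ltnW N1) // => dn.
symmetry; apply: (legendre_square_mul pp p2 (a := n) cu' cu).
by rewrite mulrC; apply: dvdz_trans dn; rewrite dvdzE /= dvdn_exp.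
Qed.

(** The generator is sent to n times a generator, so u' n^2 = u modulo 2^(k+1); hence n is odd and
    n^2 is 1 modulo 8. *)
Lemma isometric_two_two (k : nat) (u u' : nat) : (0 < k)%N -> odd u -> odd u' ->
  isometric (two_datum R k u) (two_datum R k u') ->
  ((u = u' %[mod 4]) /\ ((2 <= k)%N -> u = u' %[mod 8]))%N.
Proof.
move=> k0 ou ou' [h [_ _ hq]]; have [n nE] := Zp_gen (h (1 : 'Z_(2 ^ k))).
have := hq (1 : 'Z_(2 ^ k)); rewrite nE qform_two_datum.
rewrite -[_ *+ n]/((1 : 'Z_(2 ^ k)) *~ n%:Z) (qformMz (two_datum_theory R k0 ou')).
rewrite qform_two_datum frMz => /eqP; rewrite fr_eq ?expn_gt0 // => dn.
have d4 : (4 %| u'%:Z * (n%:Z * n%:Z) - u%:Z)%Z.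
  by apply: dvdz_trans dn; rewrite dvdzE /= (@dvdn_exp2l 2 2) // ltnS.
have odd_n : odd n.
  apply/negPn/negP => en; have /dvdzP[q Eq] := d4.
  have nn : n%:Z = 2 * n./2%:Z by lia.
  by rewrite nn in Eq; move: ou; lia.
pose m : int := (n./2)%:Z.
have nm : n%:Z * n%:Z = 4 * (m * (m + 1)) + 1.
  by rewrite (_ : n%:Z = 2 * m + 1); [ring|rewrite /m; lia].
have [r mr] : exists r, m * (m + 1) = 2 * r.
  have /dvdzP[r rE] : (2 %| m * (m + 1))%Z.
    by rewrite dvdzE abszM Euclid_dvdM //; apply/orP; move: (m) => i; clear; lia.
  by exists r; rewrite rE mulrC.
have nnE : n%:Z * n%:Z = 8 * r + 1 by rewrite nm mr; ring.
split=> [|k2].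
  move: d4; rewrite nnE => /dvdzP[q Eq].
  have : u'%:Z - u%:Z = 4 * (q - 2 * (u'%:Z * r)) by apply: (eqr_comb Eq); ring.
  by move: (q - _) => i; clear; lia.
have : (8 %| u'%:Z * (n%:Z * n%:Z) - u%:Z)%Z.
  by apply: dvdz_trans dn; rewrite dvdzE /= (@dvdn_exp2l 2 3).
rewrite nnE => /dvdzP[q Eq].
have : u'%:Z - u%:Z = 8 * (q - u'%:Z * r) by apply: (eqr_comb Eq); ring.
by move: (q - _) => i; clear; lia.
Qed.

(** Equal orders force k = 2k', and then 2^k' kills the rank two group but not the cyclic one. *)
Lemma not_isometric_two_bilinear (k k' u : nat) (al be ga : int) D : (0 < k)%N -> (0 < k')%N ->
  bilinear_datum k' al be ga D -> ~ isometric (two_datum R k u) D.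
Proof.
move=> k0 k'0 dD iso; have [cD expD _] := bilinear_datum_frame k'0 dD.
have := isometric_card iso; rewrite card_two_datum // cD => /eqP.
rewrite eqn_exp2l // => /eqP kE; have [h [hD hb _]] := isometric_sym iso.
have [g hK gK] := hb.
have z : (1 : 'Z_(2 ^ k)) *+ 2 ^ k' = 0.
  rewrite -(gK 1) -(morphMn _ _ hD) expD.
  by have := morphMn 0 0 hD; rewrite !mulr0n.
have := congr1 (fun z : 'Z_(2 ^ k) => z : nat) z; rewrite /= val_Zp_nat ?pow2_gt1 //.
rewrite modn_small; first by move/eqP; rewrite -leqn0 leqNgt expn_gt0.
by rewrite ltn_exp2l // kE -addnn -{1}(addn0 k') ltn_add2l.
Qed.

(** E_k has an isotropic element of order 2^k. In F_k an isotropic element has s^2 + t^2 - s t even,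
    which forces s and t even, so 2^(k-1) kills it. *)
Lemma not_isometric_E_F (k : nat) D D' : (0 < k)%N ->
  bilinear_datum k 0 0 1 D -> bilinear_datum k 1 1 (-1) D' -> ~ isometric D D'.
Proof.
move=> k0 dD dD' [h [hD [g hK gK] hq]].
have [_ _ [x [y [fxy _]]]] := bilinear_datum_frame k0 dD.
have [_ expD' [x' [y' [fxy' gen']]]] := bilinear_datum_frame k0 dD'.
have [[thD _] _ _] : is_prime_anyon_theory D by apply: bilinear_datum_prime dD.
have [[thD' _] _ _] : is_prime_anyon_theory D' by apply: bilinear_datum_prime dD'.
have N0 : (0 < 2 ^ k)%N by rewrite expn_gt0.
have dvd2 : (2%:Z %| (2 ^ k)%N%:Z)%Z by rewrite dvdzE /= dvdn_exp.
have [xK _ qx _ bxy] := fxy; have [s [t hx]] := gen' (h x).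
have : qform (h x) = 0 by rewrite hq qx fr0.
rewrite hx; have -> := qform_frame thD' s t fxy'; move/eqP; rewrite fr_eq0 //.
move=> /(dvdz_trans dvd2)/dvdzP[q Eq].
have [es et] : ~~ odd s /\ ~~ odd t.
  have sE : s%:Z = 2 * s./2%:Z + odd s by lia.
  have tE : t%:Z = 2 * t./2%:Z + odd t by lia.
  move: Eq; rewrite sE tE; move: (s./2%:Z) (t./2%:Z) => i j.
  by case: (odd s); case: (odd t) => /= Eq; split=> //; exfalso; lia.
have hx2 : h x *+ 2 ^ k.-1 = 0.
  rewrite hx -(even_halfK es) -(even_halfK et) -!muln2 !mulrnA -mulrnDl -mulrnA.
  by rewrite -expnS prednK // expD'.
have x2 : x *+ 2 ^ k.-1 = 0.
  rewrite -(hK (x *+ _)) (morphMn _ _ hD) hx2.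
  have h0 : h 0 = 0 by have := morphMn 0 0 hD; rewrite !mulr0n.
  by rewrite -h0 hK.
have := bformMzl thD x y (2 ^ k.-1)%N.
rewrite -[x *~ _]/(x *+ 2 ^ k.-1) x2 (bform0l thD) bxy frMz mul1r => /esym/eqP.
rewrite fr_eq0 // dvdzE /= => /dvdn_leq; rewrite expn_gt0 /= => /(_ isT).
by rewrite leq_exp2l // leqNgt prednK // leqnn.
Qed.

(* Only used to reduce the comparison of two names to one order of the constructors. *)
Definition name_rank l : nat :=
  match l with OmegaOdd _ _ _ => 0 | OmegaTwo _ _ => 1 | TypeE _ => 2 | TypeF _ => 3 end.

Lemma isometric_name l l' D D' : listed l -> listed l' -> denotes l D -> denotes l' D' ->
  isometric D D' -> l = l'.
Proof.
wlog : l l' D D' / (name_rank l <= name_rank l')%N.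
  move=> H L L' dD dD' iso; case: (leqP (name_rank l) (name_rank l')) => [|/ltnW] le.
    exact: H le L L' dD dD' iso.
  by apply/esym; apply: H le L' L dD' dD (isometric_sym iso).
have odd_two p k n : prime p -> p <> 2%N -> (0 < k)%N -> (p ^ k = 2 ^ n)%N -> False.
  move=> pp p2 k0 E; apply: p2; apply/eqP; rewrite -dvdn_prime2 //.
  have : (p %| 2 ^ n)%N by rewrite -E dvdn_exp.
  by rewrite Euclid_dvdX // => /andP[].
case: l => [p k eps|k eps|k|k]; case: l' => [p' k' eps'|k' eps'|k'|k'] // _ L L'.
- case: L L' => pp p2 k0 _ [pp' p2' k0' _] [u [_ cu lu ->]] [u' [_ cu' lu' ->]] iso.
  have := isometric_card iso; rewrite !card_odd_datum ?prime_exp_gt1 // => E.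
  have pE : p = p'.
    apply/eqP; rewrite -dvdn_prime2 //; have : (p %| p' ^ k')%N by rewrite -E dvdn_exp.
    by rewrite Euclid_dvdX // => /andP[].
  subst p'; move/eqP: E; rewrite eqn_exp2l ?prime_gt1 // => /eqP kE; subst k'.
  by rewrite -lu -lu' (isometric_odd_odd pp p2 k0 cu cu' iso).
- case: L => pp p2 k0 _ [u [_ cu lu ->]] [u' [_ /(listed_two_odd L')[k0' ou'] ->]].
  move/isometric_card; rewrite card_odd_datum ?prime_exp_gt1 // card_two_datum //.
  by move/(odd_two p k _ pp p2 k0).
- case: L => pp p2 k0 _ [u [_ cu lu ->]] /denotesE/(bilinear_datum_frame L')[cD' _ _].
  by move/isometric_card; rewrite card_odd_datum ?prime_exp_gt1 // cD' => /(odd_two p k _ pp p2 k0).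
- case: L => pp p2 k0 _ [u [_ cu lu ->]] /denotesF/(bilinear_datum_frame L')[cD' _ _].
  by move/isometric_card; rewrite card_odd_datum ?prime_exp_gt1 // cD' => /(odd_two p k _ pp p2 k0).
- move=> [u [_ ueps ->]] [u' [_ ueps' ->]] iso.
  have [k0 ou] := listed_two_odd L ueps; have [k0' ou'] := listed_two_odd L' ueps'.
  have := isometric_card iso; rewrite !card_two_datum // => /eqP.
  rewrite eqn_exp2l // => /eqP kE; subst k'.
  have [m4 m8] := isometric_two_two k0 ou ou' iso.
  have v8 := @val_Zp_nat 8 isT u; have v8' := @val_Zp_nat 8 isT u'; rewrite ueps in v8.
  rewrite ueps' in v8'; congr OmegaTwo; apply: val_inj.
  rewrite [LHS]v8 [RHS]v8'; have [/m8 //|k1] := leqP 2 k.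
  (* For k = 1 only the residue modulo 4 is available; it separates 1 from 7, the only values listed
     there. *)
  have small (e : 'Z_8) : listed (OmegaTwo k e) -> e = 1%N :> nat \/ e = 7%N :> nat.
    by move=> [[_ [->|->]]|[]]; [left|right|rewrite leqNgt k1].
  by move: m4 (small _ L) (small _ L'); rewrite v8 v8'; clear; lia.
- move=> [u [_ /(listed_two_odd L)[k0 ou] ->]] /denotesE dD'.
  by move/(not_isometric_two_bilinear k0 L' dD').
- move=> [u [_ /(listed_two_odd L)[k0 ou] ->]] /denotesF dD'.
  by move/(not_isometric_two_bilinear k0 L' dD').
- move=> /denotesE dD /denotesE dD' /isometric_card.
  have [-> _ _] := bilinear_datum_frame L dD; have [-> _ _] := bilinear_datum_frame L' dD'.
  by move/eqP; rewrite eqn_exp2l // => /eqP/double_inj ->.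
- move=> /denotesE dD /denotesF dD' iso; exfalso; move: iso (isometric_card iso).
  have [-> _ _] := bilinear_datum_frame L dD; have [-> _ _] := bilinear_datum_frame L' dD'.
  move=> iso /eqP; rewrite eqn_exp2l // => /eqP/double_inj kE; subst k'.
  exact: not_isometric_E_F L dD dD' iso.
- move=> /denotesF dD /denotesF dD' /isometric_card.
  have [-> _ _] := bilinear_datum_frame L dD; have [-> _ _] := bilinear_datum_frame L' dD'.
  by move/eqP; rewrite eqn_exp2l // => /eqP/double_inj ->.
Qed.

End Names.

Theorem theorem5p4 (R : realType) :
  [/\ forall l : theory_name, listed l -> exists D : abelian_datum R, denotes l D,
      forall (l : theory_name) (D : abelian_datum R),
        listed l -> denotes l D -> is_prime_anyon_theory D,
      forall (l : theory_name) (D D' : abelian_datum R),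
        listed l -> denotes l D -> denotes l D' -> equivalent D D'
    & forall D : abelian_datum R, is_prime_anyon_theory D ->
        exists! l : theory_name,
          listed l /\ exists D' : abelian_datum R, denotes l D' /\ equivalent D D'].
Proof.
split.
- exact: denotes_exists.
- exact: denotes_prime.
- exact: denotes_equivalent.
- move=> D /prime_classified[l [L [D' [dD' eqv]]]]; exists l; split; first by split=> //; exists D'.
  move=> l' [L' [D'' [dD'' eqv']]]; apply: (isometric_name L L' dD' dD'').
  exact: isometric_trans (isometric_sym (equivalent_isometric eqv)) (equivalent_isometric eqv').
Qed.
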